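(* Let $u$ be the total field of the TM-polarized cavity scattering problem described in the context, with cavity aperture $\Gamma=[a,b]\times\{0\}$. The transparent boundary condition on $\Gamma$, $$\partial_{x_2}u(x_1,0)=\frac{{\rm i}\kappa_0}{2}\int_{\Gamma}\frac{1}{|x_1-y_1|}H_1^{(1)}(\kappa_0|x_1-y_1|)\,u(y_1,0)\,{\rm d}y_1-2{\rm i}\beta e^{{\rm i}\alpha x_1},$$ in which the hypersingular integral is defined in the sense of the Hadamard finite part, can be reformulated as follows: $$\partial_{x_2}u(x_1,0)=\frac{{\rm i}\kappa_0^2}{2}\int_{\Gamma}u(y_1,0)H_0^{(1)}(\kappa_0|x_1-y_1|)\,{\rm d}y_1+\frac{{\rm i}}{2}\partial_{x_1}\left[\int_{\Gamma}\partial_{y_1}u(y_1,0)\,H_0^{(1)}(\kappa_0|x_1-y_1|)\,{\rm d}y_1\right]-2{\rm i}\beta e^{{\rm i}\alpha x_1}.$$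
   Context: Points of the plane are written $(x_1,x_2)$, and $\mathbb R^2_+=\{x_2>0\}$. A rectangular cavity with cross-section $\Omega$ lies below the line $x_2=0$; $\Gamma_c$ denotes its vertical walls and bottom, $\Gamma=[a,b]\times\{0\}$ its open aperture, and $\Gamma_g$ the infinite ground plane, i.e. the rest of the line $x_2=0$. The medium in $\mathbb R^2_+$ is homogeneous with constant wavenumber $\kappa_0$; the cavity may be filled with a (layered) medium, and $\kappa$ denotes the wavenumber in $\mathbb R^2_+\cup\Omega$, with $\Im\kappa\ge 0$ and $\kappa=\kappa_0$ in $\mathbb R^2_+$. The incident plane wave is $u^i(x_1,x_2)=e^{{\rm i}(\alpha x_1-\beta x_2)}$ with $\alpha=\kappa_0\sin\theta$, $\beta=\kappa_0\cos\theta$, $\theta\in(-\pi/2,\pi/2)$, and the reflected field is $u^r(x_1,x_2)=e^{{\rm i}(\alpha x_1+\beta x_2)}$. The total field $u$ satisfies $\Delta u+\kappa^2u=0$ in $\mathbb R^2_+\cup\Omega$, the perfect-conductor condition $u=0$ on $\Gamma_g\cup\Gamma_c$, and continuity of $u$ and $\partial_{x_2}u$ across $\Gamma$; the scattered field $u^s=u-u^i+u^r$ satisfies the Sommerfeld radiation condition $\lim_{r\to\infty}\sqrt r\,(\partial_ru^s-{\rm i}\kappa_0u^s)=0$, $r=\sqrt{x_1^2+x_2^2}$. $H_0^{(1)}$ and $H_1^{(1)}$ are the Hankel functions of the first kind of orders $0$ and $1$; $\int_\Gamma\cdot\,{\rm d}y_1$ means integration over $y_1\in[a,b]$. On $\Gamma$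 the values $u(x_1,0)$ and $\partial_{x_2}u(x_1,0)$ are taken from the upper side, i.e. at $x_2=0^+$. *)

(* Defs.v *)
From Stdlib Require Import Reals Arith List.
From Coquelicot Require Import Coquelicot.
Open Scope R_scope.

(** * Bessel and Hankel functions of integer order, for a real argument z > 0 *)

Definition bessel_J (n : nat) (z : R) : R :=
  Series (fun k : nat =>
    (-1) ^ k / (INR (fact k) * INR (fact (n + k))) * (z / 2) ^ (2 * k + n)).

Fixpoint harmonic (n : nat) : R :=
  match n with
  | O => 0
  | S m => harmonic m + / INR (S m)
  end.

Definition euler_gamma : R :=
  real (Lim_seq (fun n : nat => harmonic n - ln (INR n))).

(** psi (m + 1), where psi is the digamma function *)
Definition digamma_S (m : nat) : R := harmonic m - euler_gamma.

Definition list_sum (l : list R) : R := fold_right Rplus 0 l.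

(** The standard series of the Bessel function of the second kind. *)
Definition bessel_Y (n : nat) (z : R) : R :=
  2 / PI * ln (z / 2) * bessel_J n z
  - / PI * list_sum (map (fun k : nat =>
        INR (fact (n - k - 1)) / INR (fact k) * (z / 2) ^ (2 * k) / (z / 2) ^ n)
      (seq 0 n))
  - / PI * Series (fun k : nat =>
        (digamma_S k + digamma_S (n + k)) *
        ((-1) ^ k / (INR (fact k) * INR (fact (n + k))) * (z / 2) ^ (2 * k + n))).

Definition hankel1 (n : nat) (z : R) : C := (bessel_J n z, bessel_Y n z).

(** * Calculus of complex-valued functions of one or two real variables *)

(** exp (i t) *)
Definition cis (t : R) : C := (cos t, sin t).

Definition ex_Cderive (f : R -> C) (x : R) : Prop :=
  @ex_derive R_AbsRing C_R_NormedModule f x.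

Definition Cderive (f : R -> C) (x : R) : C :=
  (Derive (fun t => fst (f t)) x, Derive (fun t => snd (f t)) x).

Definition d1 (f : R * R -> C) (p : R * R) : C :=
  Cderive (fun s => f (s, snd p)) (fst p).

Definition d2 (f : R * R -> C) (p : R * R) : C :=
  Cderive (fun s => f (fst p, s)) (snd p).

Definition laplacian (f : R * R -> C) (p : R * R) : C :=
  (d1 (d1 f) p + d2 (d2 f) p)%C.

Definition C1_at (f : R * R -> C) (p : R * R) : Prop :=
  locally p (fun q => ex_Cderive (fun s => f (s, snd q)) (fst q) /\
                      ex_Cderive (fun s => f (fst q, s)) (snd q)) /\
  continuous (d1 f) p /\ continuous (d2 f) p.

Definition C2_at (f : R * R -> C) (p : R * R) : Prop :=
  C1_at f p /\ C1_at (d1 f) p /\ C1_at (d2 f) p.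

(** * Geometry: the cavity is (a, b) x (-h, 0) *)

Definition upper_half_plane (p : R * R) : Prop := 0 < snd p.

Definition cavity (a b h : R) (p : R * R) : Prop :=
  a < fst p < b /\ - h < snd p < 0.

Definition open_aperture (a b : R) (p : R * R) : Prop :=
  a < fst p < b /\ snd p = 0.

Definition ground_plane (a b : R) (p : R * R) : Prop :=
  (fst p < a \/ b < fst p) /\ snd p = 0.

Definition cavity_walls (a b h : R) (p : R * R) : Prop :=
  ((fst p = a \/ fst p = b) /\ - h <= snd p <= 0) \/
  (a <= fst p <= b /\ snd p = - h).

Definition closed_domain (a b h : R) (p : R * R) : Prop :=
  0 <= snd p \/ (a <= fst p <= b /\ - h <= snd p <= 0).

(** * The scattering problem *)

(** The points having a neighbourhood on which the wavenumber is continuous: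
    layer interfaces consist of points that are not regular. *)
Definition regular_point (kappa : R * R -> C) (p : R * R) : Prop :=
  locally p (fun q => continuous kappa q).

Record medium (kappa0 a b h : R) (kappa : R * R -> C) : Prop := {
  medium_upper : forall p, upper_half_plane p -> kappa p = RtoC kappa0;
  medium_Im_ge0 : forall p,
    upper_half_plane p \/ cavity a b h p -> 0 <= Im (kappa p);
  medium_piecewise_continuous : forall p, cavity a b h p ->
    forall U : R * R -> Prop, locally p U ->
    exists q, U q /\ regular_point kappa q
}.

Definition alpha (kappa0 theta : R) : R := kappa0 * sin theta.
Definition beta (kappa0 theta : R) : R := kappa0 * cos theta.

Definition incident (kappa0 theta : R) (p : R * R) : C :=
  cis (alpha kappa0 theta * fst p - beta kappa0 theta * snd p).

Definition reflected (kappa0 theta : R) (p : R * R) : C :=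
  cis (alpha kappa0 theta * fst p + beta kappa0 theta * snd p).

Definition scattered (kappa0 theta : R) (u : R * R -> C) (p : R * R) : C :=
  (u p - incident kappa0 theta p + reflected kappa0 theta p)%C.

Definition polar (r phi : R) : R * R := (r * cos phi, r * sin phi).

(** The limit is uniform with respect to the direction in the half plane. *)
Definition sommerfeld (kappa0 : R) (v : R * R -> C) : Prop :=
  forall eps : R, 0 < eps -> exists r0 : R, 0 < r0 /\
    forall r phi : R, r0 < r -> 0 < phi < PI ->
      Cmod (RtoC (sqrt r) *
            (Cderive (fun s => v (polar s phi)) r
             - Ci * RtoC kappa0 * v (polar r phi)))%C < eps.

(** Classical solutions.  [tf_C1] contains the transmission conditions: u and
    its first derivatives are continuous across the aperture and across the
    interfaces inside the cavity.  [tf_continuous] makes [u (x, 0)] the trace of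
    u from the upper side. *)
Record total_field (kappa0 theta a b h : R) (kappa u : R * R -> C) : Prop := {
  tf_continuous : forall p, closed_domain a b h p ->
    filterlim u (within (closed_domain a b h) (locally p)) (locally (u p));
  tf_C1 : forall p,
    upper_half_plane p \/ open_aperture a b p \/ cavity a b h p -> C1_at u p;
  tf_helmholtz : forall p,
    upper_half_plane p \/ cavity a b h p -> regular_point kappa p ->
    C2_at u p /\ (laplacian u p + kappa p * kappa p * u p)%C = RtoC 0;
  tf_conductor : forall p,
    ground_plane a b p \/ cavity_walls a b h p -> u p = RtoC 0;
  tf_radiation : sommerfeld kappa0 (scattered kappa0 theta u)
}.

(** * Singular and hypersingular integrals over [a, b] *)

(** Integral of a function that is singular at x and possibly at a and b. *)
Definition is_improper_RInt (f : R -> C) (a x b : R) (l : C) : Prop :=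
  exists l1 l2 : C,
    @is_RInt_gen C_R_NormedModule f (at_right a) (at_left x) l1 /\
    @is_RInt_gen C_R_NormedModule f (at_right x) (at_left b) l2 /\
    l = (l1 + l2)%C.

(** Hadamard finite part at x: in the expansion, as eps -> 0+, of the integral
    over [a, b] \ (x - eps, x + eps), the terms in 1 / eps and ln eps are
    discarded. *)
Definition is_finite_part (f : R -> C) (a x b : R) (l : C) : Prop :=
  exists (A B : C) (I : R -> C),
    (forall eps : R, 0 < eps < Rmin (x - a) (b - x) ->
       exists l1 l2 : C,
         @is_RInt C_R_NormedModule f a (x - eps) l1 /\
         @is_RInt C_R_NormedModule f (x + eps) b l2 /\
         I eps = (l1 + l2)%C) /\
    filterlim (fun eps : R => (I eps - A * RtoC (/ eps) - B * RtoC (ln eps))%C)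
      (at_right 0) (locally l).

(** * The two boundary conditions at the point (x, 0) of the aperture *)

Definition upper_normal_derivative (u : R * R -> C) (x : R) (v : C) : Prop :=
  filterlim (fun s : R => d2 u (x, s)) (at_right 0) (locally v).

Definition incident_term (kappa0 theta x : R) : C :=
  (RtoC 2 * Ci * RtoC (beta kappa0 theta) * cis (alpha kappa0 theta * x))%C.

Definition hypersingular_tbc
    (kappa0 theta a b : R) (u : R * R -> C) (x : R) : Prop :=
  exists v F : C,
    upper_normal_derivative u x v /\
    is_finite_part
      (fun y => (RtoC (/ Rabs (x - y)) * hankel1 1 (kappa0 * Rabs (x - y))
                 * u (y, 0))%C) a x b F /\
    v = (Ci * RtoC kappa0 / RtoC 2 * F - incident_term kappa0 theta x)%C.

Definition reformulated_tbc
    (kappa0 theta a b : R) (u : R * R -> C) (x : R) : Prop :=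
  exists (v G D : C) (V : R -> C),
    upper_normal_derivative u x v /\
    is_improper_RInt
      (fun y => (u (y, 0) * hankel1 0 (kappa0 * Rabs (x - y)))%C) a x b G /\
    (forall s : R, a < s < b ->
       is_improper_RInt
         (fun y => (d1 u (y, 0) * hankel1 0 (kappa0 * Rabs (s - y)))%C)
         a s b (V s)) /\
    @is_derive R_AbsRing C_R_NormedModule V x D /\
    v = (Ci * RtoC (kappa0 ^ 2) / RtoC 2 * G + Ci / RtoC 2 * D
         - incident_term kappa0 theta x)%C.

(* Main.v *)
Require Import Defs.
From Stdlib Require Import Reals Arith Lra Lia Psatz FunctionalExtensionality.
From Coquelicot Require Import Coquelicot.
Open Scope R_scope.

(** Let [f] be the trace of [u] on the aperture, [phi t = H0 (k |t|)] and
    [psi t = k H1 (k |t|) / |t|]; Bessel's equation reads [phi'' + k^2 phi = psi],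
    so the finite part of [f psi] is [k^2] times the weakly singular integral plus
    the finite part of [f phi''].  The function [f] is only known to be [C^1], hence
    neither the finite part nor the derivative of
    [V s = int f' (y) phi (s - y) dy] needs to exist, and what has to be shown is
    that they exist together and agree.  This follows from the unconditional limit
    [int_{|y - x| > |h|} f (y) phi'' (x - y) dy + 2 c f (x) / |h|
       - (V (x + h) - V x) / h -> 0] as [h -> 0], where [phi t ~ c ln |t|] at [0].
    Integrating by parts, [V s] becomes a proper integral of the continuous
    function [(f y - f s) phi' (s - y)]; the affine part of [f] at [x] is then
    explicit, and the remainder [r] satisfies [|r'| <= eta] near [x], so that the
    region [|y - x| < 2 |h|] and (by Taylor's formula for [phi']) its complement
    both contribute [O (eta)].  Finally, finite parts with unknown coefficients of
    [1 / eps] and [ln eps] are compared at [eps] and [eps / 2], which forces the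
    coefficients to be the expected ones. *)

(** * Bessel functions *)

(** The derivative of the trace is known to be continuous on the open aperture only and may blow up
    at the edges, so the integrals of [f' phi] are improper at [a] and [b] as well as at [s].
    Integrating by parts with [f y - f s] instead of [f] settles both: the resulting primitive
    involves only values of [f], besides the number [f' s], so it has limits at [a] and [b], and its
    boundary term vanishes at [s]. The corners [(a, 0)] and [(b, 0)] lie on the conducting walls, so
    [f] is zero there, and the boundary terms at the edges reduce to multiples of [f s],
    differentiable in [s]. Since [phi] is even, the values [phi (eps)] coming from the two sides of
    [x] cancel; this is why the expected coefficient of [ln eps] is 0. Both boundary conditions
    speak of the same normal derivative [v], so everything comes down to the relation
    [k F = k^2 G + D] between the finite part [F], the weak integral [G] and the derivative [D]. *)

(** Interface shared by the pair of [J_0, J_1], with [c = 0], and the pair of [Y_0, Y_1], with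
    [c = 2 / PI], so that the analysis is done once for real kernels. The two derivative rules
    together are Bessel's equation of order 0; the limit of [K1 + c / z] encodes [K0 ~ c ln z]. *)
Record radial_kernel (c : R) (K0 K1 : R -> R) : Prop := {
  rk_derive0 : forall z, 0 < z -> is_derive K0 z (- K1 z);
  rk_derive1 : forall z, 0 < z -> is_derive K1 z (K0 z - K1 z / z);
  rk_lim1 : filterlim (fun z => K1 z + c / z) (at_right 0) (locally 0);
  rk_lim0 : filterlim (fun z => z * K0 z) (at_right 0) (locally 0)
}.

(** Coefficients with respect to [w = (z / 2)^2], once the factor [(z / 2)^n] is taken out; this
    turns the Bessel series into genuine power series. *)
Definition coef_J (n k : nat) : R :=
  (-1) ^ k / (INR (fact k) * INR (fact (n + k))).

Definition coef_Y (n k : nat) : R :=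
  (digamma_S k + digamma_S (n + k)) * coef_J n k.

(** The exponential series is a majorant: each [|a_k| r^k] is at most [M exp r], so every [r] is
    below the radius. *)
Lemma CV_radius_entire (a : nat -> R) (M : R) :
  (forall k, Rabs (a k) <= M / INR (fact k)) -> CV_radius a = p_infty.
Proof.
  intros H.
  assert (HM : 0 <= M).
  { specialize (H O). simpl in H. pose proof (Rabs_pos (a O)). lra. }
  destruct (CV_radius_bounded a) as [Hub _].
  apply Rbar_le_antisym.
  { destruct (CV_radius a); simpl; auto. }
  assert (Hr : forall r : R, 0 <= r -> Rbar_le r (CV_radius a)).
  { intros r Hr. apply Hub. exists (M * exp r). intros n.
    rewrite Rabs_mult, (Rabs_pos_eq (r ^ n)) by (apply pow_le; lra).
    apply Rle_trans with (M / INR (fact n) * r ^ n).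
    { apply Rmult_le_compat_r; [apply pow_le; lra | apply H]. }
    unfold Rdiv. rewrite Rmult_assoc, (Rmult_comm (/ _)). apply Rmult_le_compat_l; [exact HM|].
    set (e := fun k => r ^ k * / INR (fact k)).
    assert (He : is_series e (exp r)).
    { eapply is_series_ext; [|exact (is_exp_Reals r)]. intros k. unfold e. now rewrite <- pow_n_pow. }
    assert (Hpos : forall k, 0 <= e k).
    { intros k. apply Rmult_le_pos; [apply pow_le; lra|]. left. apply Rinv_0_lt_compat, INR_fact_lt_0. }
    assert (Hsum : forall k, 0 <= sum_n e k).
    { intros k. induction k; [rewrite sum_O; apply Hpos|]. rewrite sum_Sn.
      specialize (Hpos (S k)). unfold plus; simpl. lra. }
    (* The terms are nonnegative, so the single term [e n] is at most every partial sum from index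
       [n] on, hence at most their limit [exp r]. *)
    apply (is_lim_seq_le (fun _ => e n) (fun m => sum_n e (m + n)) (e n) (exp r)).
    - intros m. apply Rle_trans with (sum_n e n).
      + destruct n as [|n]; [rewrite sum_O; lra|].
        rewrite sum_Sn. specialize (Hsum n). unfold plus; simpl. lra.
      + clear -Hpos. induction m; [simpl; lra|].
        change (S m + n)%nat with (S (m + n)). rewrite sum_Sn.
        specialize (Hpos (S (m + n))). unfold plus in *; simpl in *. lra.
    - apply is_lim_seq_const.
    - apply (is_lim_seq_incr_n (fun m => sum_n e m)). exact He. }
  destruct (CV_radius a) as [v| |]; simpl in *; auto.
  - specialize (Hr (Rabs v + 1)). pose proof (Rle_abs v). pose proof (Rabs_pos v). lra.
  - apply (Hr 0). lra.
Qed.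

Lemma coef_J_bound (n k : nat) : Rabs (coef_J n k) <= / (INR (fact k) * INR (fact (n + k))).
Proof.
  unfold coef_J, Rdiv. rewrite Rabs_mult, <- RPow_abs, Rabs_m1, pow1, Rmult_1_l.
  apply Req_le, Rabs_pos_eq. left. apply Rinv_0_lt_compat, Rmult_lt_0_compat; apply INR_fact_lt_0.
Qed.

Lemma INR_fact_ge_1 (n : nat) : 1 <= INR (fact n).
Proof. apply (le_INR 1). pose proof (lt_O_fact n). lia. Qed.

Lemma CV_radius_coef_J (n : nat) : CV_radius (coef_J n) = p_infty.
Proof.
  apply CV_radius_entire with 1. intros k. eapply Rle_trans; [apply coef_J_bound|].
  pose proof (INR_fact_ge_1 k). pose proof (INR_fact_ge_1 (n + k)).
  unfold Rdiv. rewrite Rmult_1_l. apply Rinv_le_contravar; nra.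
Qed.

Lemma harmonic_bounds (n : nat) : 0 <= harmonic n <= INR n.
Proof.
  induction n as [|n IH]; [simpl; lra|].
  change (harmonic (S n)) with (harmonic n + / INR (S n)).
  assert (1 <= INR (S n)) by (rewrite S_INR; pose proof (pos_INR n); lra).
  assert (0 < / INR (S n)) by (apply Rinv_0_lt_compat; lra).
  assert (/ INR (S n) <= 1) by (rewrite <- Rinv_1; apply Rinv_le_contravar; lra).
  rewrite S_INR in *. lra.
Qed.

Lemma INR_le_fact (n : nat) : INR n <= INR (fact n).
Proof. apply le_INR. destruct n; simpl; [lia|]. pose proof (lt_O_fact n). nia. Qed.

(** The harmonic numbers grow at most linearly, which the factorial of [n + k] absorbs; the
    factorial of [k] is left for the majorant. *)
Lemma CV_radius_coef_Y (n : nat) : CV_radius (coef_Y n) = p_infty.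
Proof.
  apply CV_radius_entire with (2 + 2 * Rabs euler_gamma). intros k.
  unfold coef_Y. rewrite Rabs_mult.
  pose proof (coef_J_bound n k) as Hb.
  pose proof (harmonic_bounds k). pose proof (harmonic_bounds (n + k)) as Hnk.
  assert (Hd : Rabs (digamma_S k + digamma_S (n + k)) <= 2 * INR (n + k) + 2 * Rabs euler_gamma).
  { unfold digamma_S. pose proof (Rle_abs euler_gamma).
    pose proof (Rle_abs (- euler_gamma)). rewrite Rabs_Ropp in *.
    rewrite plus_INR in *. pose proof (pos_INR n). apply Rabs_le. lra. }
  pose proof (INR_fact_lt_0 k) as Hk. pose proof (INR_fact_ge_1 (n + k)) as H1.
  pose proof (INR_le_fact (n + k)) as H2. pose proof (Rabs_pos euler_gamma).
  pose proof (pos_INR n).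
  eapply Rle_trans; [apply Rmult_le_compat; [apply Rabs_pos|apply Rabs_pos|exact Hd|exact Hb]|].
  rewrite Rinv_mult. unfold Rdiv. rewrite (Rmult_comm (/ INR (fact k))), <- Rmult_assoc.
  apply Rmult_le_compat_r; [left; now apply Rinv_0_lt_compat|].
  apply Rmult_le_reg_r with (INR (fact (n + k))); [lra|].
  rewrite Rmult_assoc, Rinv_l by lra. nra.
Qed.

(** * Power series of J and Y, and the relations between them *)

Lemma is_derive_entire (a : nat -> R) (x : R) :
  CV_radius a = p_infty -> is_derive (PSeries a) x (PSeries (PS_derive a) x).
Proof. intros H. apply is_derive_PSeries. now rewrite H. Qed.

Lemma ex_pseries_entire (a : nat -> R) (x : R) :
  CV_radius a = p_infty -> ex_pseries a x.
Proof. intros H. apply CV_radius_inside. now rewrite H. Qed.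

Lemma bessel_series (c : nat -> R) (n : nat) (z : R) :
  Series (fun k => c k * (z / 2) ^ (2 * k + n)) = (z / 2) ^ n * PSeries c ((z / 2) ^ 2).
Proof.
  unfold PSeries. rewrite <- Series_scal_l. apply Series_ext. intros k.
  rewrite pow_add, pow_mult. ring.
Qed.

Lemma bessel_J_PSeries (n : nat) (z : R) :
  bessel_J n z = (z / 2) ^ n * PSeries (coef_J n) ((z / 2) ^ 2).
Proof. apply bessel_series. Qed.

Lemma bessel_Y0_PSeries (z : R) :
  bessel_Y 0 z = 2 / PI * ln (z / 2) * PSeries (coef_J 0) ((z / 2) ^ 2)
                 - / PI * PSeries (coef_Y 0) ((z / 2) ^ 2).
Proof.
  unfold bessel_Y. rewrite bessel_J_PSeries.
  rewrite (Series_ext _ (fun k => coef_Y 0 k * (z / 2) ^ (2 * k + 0))).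
  2: { intros k; unfold coef_Y, coef_J; ring. }
  rewrite bessel_series. simpl. ring.
Qed.

Lemma bessel_Y1_PSeries (z : R) : 0 < z ->
  bessel_Y 1 z = 2 / PI * ln (z / 2) * (z / 2 * PSeries (coef_J 1) ((z / 2) ^ 2))
                 - / PI * (2 / z) - / PI * (z / 2 * PSeries (coef_Y 1) ((z / 2) ^ 2)).
Proof.
  intros Hz. unfold bessel_Y. rewrite bessel_J_PSeries.
  rewrite (Series_ext _ (fun k => coef_Y 1 k * (z / 2) ^ (2 * k + 1))).
  2: { intros k; unfold coef_Y, coef_J; ring. }
  rewrite bessel_series. simpl. pose proof PI_neq0. field. lra.
Qed.

(** With [S_n] the series of [coef_J n] in [w], this and [coef_J1_succ] are the coefficient forms of
    [S_0' = - S_1] and [(w S_1)' = S_0]. *)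
Lemma coef_J0_succ (k : nat) : INR (S k) * coef_J 0 (S k) = - coef_J 1 k.
Proof.
  unfold coef_J. rewrite !Nat.add_0_l. change (1 + k)%nat with (S k).
  rewrite (fact_simpl k), mult_INR. simpl pow.
  pose proof (INR_fact_neq_0 k). pose proof (not_0_INR (S k) ltac:(lia)). field. auto.
Qed.

Lemma coef_J1_succ (k : nat) : INR (S k) * coef_J 1 k = coef_J 0 k.
Proof.
  unfold coef_J. rewrite !Nat.add_0_l. change (1 + k)%nat with (S k).
  rewrite (fact_simpl k), mult_INR.
  pose proof (INR_fact_neq_0 k). pose proof (not_0_INR (S k) ltac:(lia)). field. auto.
Qed.

Lemma PS_derive_coef_J0 (w : R) : PSeries (PS_derive (coef_J 0)) w = - PSeries (coef_J 1) w.
Proof.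
  rewrite <- PSeries_opp. apply PSeries_ext. intros k. unfold PS_derive, PS_opp.
  rewrite coef_J0_succ. reflexivity.
Qed.

Lemma coef_J1_derive (w : R) : PSeries (coef_J 1) w + w * PSeries (PS_derive (coef_J 1)) w
  = PSeries (coef_J 0) w.
Proof.
  assert (R1 := CV_radius_coef_J 1).
  rewrite <- PSeries_incr_1, <- PSeries_plus.
  - apply PSeries_ext. intros k.
    change (coef_J 1 k + PS_incr_1 (PS_derive (coef_J 1)) k = coef_J 0 k).
    rewrite <- coef_J1_succ. destruct k; [simpl; unfold zero; simpl; ring|].
    change (PS_incr_1 (PS_derive (coef_J 1)) (S k)) with (INR (S k) * coef_J 1 (S k)).
    rewrite (S_INR (S k)). ring.
  - now apply ex_pseries_entire.
  - apply ex_pseries_incr_1, ex_pseries_entire. now rewrite CV_radius_derive.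
Qed.

Lemma digamma_S_succ (m : nat) : digamma_S (S m) = digamma_S m + / INR (S m).
Proof. unfold digamma_S. change (harmonic (S m)) with (harmonic m + / INR (S m)). ring. Qed.

(** Collects the terms without logarithm in the derivative of [Y_0]. The 1 on the right is the
    constant term of the series of [J_0]; it produces the pole [2 / (PI z)] of [Y_1]. *)
Lemma coef_Y0_derive (w : R) :
  PSeries (coef_J 0) w - w * PSeries (PS_derive (coef_Y 0)) w = 1 + w * PSeries (coef_Y 1) w.
Proof.
  assert (R1 := CV_radius_coef_Y 0). assert (R2 := CV_radius_coef_Y 1).
  rewrite (PSeries_decr_1 (coef_J 0)) by (apply ex_pseries_entire, CV_radius_coef_J).
  replace (coef_J 0 0) with 1 by (unfold coef_J; simpl; field).
  rewrite (PSeries_ext (PS_decr_1 (coef_J 0)) (PS_plus (PS_derive (coef_Y 0)) (coef_Y 1))).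
  - rewrite PSeries_plus. ring.
    apply ex_pseries_entire. now rewrite CV_radius_derive. now apply ex_pseries_entire.
  - intros k. unfold PS_decr_1, PS_plus, PS_derive. change (coef_J 0 (S k) = INR (S k) * coef_Y 0 (S k) + coef_Y 1 k).
    unfold coef_Y. rewrite Nat.add_0_l. change (1 + k)%nat with (S k).
    replace (INR (S k) * ((digamma_S (S k) + digamma_S (S k)) * coef_J 0 (S k)))
      with ((digamma_S (S k) + digamma_S (S k)) * (INR (S k) * coef_J 0 (S k))) by ring.
    pose proof (not_0_INR (S k) ltac:(lia)) as H.
    replace (coef_J 0 (S k)) with (/ INR (S k) * (INR (S k) * coef_J 0 (S k))) at 1 by (field; auto).
    rewrite coef_J0_succ, digamma_S_succ. ring.
Qed.

(** The step of the digamma function adds the series of [J_1] to that of [Y_0]; in the derivative of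
    [Y_1] it cancels the term coming from the derivative of the logarithm. *)
Lemma coef_Y1_derive (w : R) :
  PSeries (coef_Y 1) w + w * PSeries (PS_derive (coef_Y 1)) w
  = PSeries (coef_J 1) w + PSeries (coef_Y 0) w.
Proof.
  assert (R1 := CV_radius_coef_Y 1). assert (R0 := CV_radius_coef_Y 0).
  assert (R2 := CV_radius_coef_J 1).
  rewrite <- PSeries_incr_1, <- !PSeries_plus; try (now apply ex_pseries_entire).
  - apply PSeries_ext. intros k.
    change (coef_Y 1 k + PS_incr_1 (PS_derive (coef_Y 1)) k = coef_J 1 k + coef_Y 0 k).
    transitivity (INR (S k) * coef_Y 1 k).
    { destruct k; [simpl; unfold zero; simpl; ring|].
      change (PS_incr_1 (PS_derive (coef_Y 1)) (S k)) with (INR (S k) * coef_Y 1 (S k)).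
      rewrite (S_INR (S k)). ring. }
    unfold coef_Y. rewrite Nat.add_0_l. change (1 + k)%nat with (S k).
    rewrite <- (coef_J1_succ k), digamma_S_succ.
    pose proof (not_0_INR (S k) ltac:(lia)). field. auto.
  - apply ex_pseries_incr_1, ex_pseries_entire. now rewrite CV_radius_derive.
Qed.

Lemma is_derive_entire_sqr (a : nat -> R) (z : R) :
  CV_radius a = p_infty ->
  is_derive (fun t => PSeries a ((t / 2) ^ 2)) z (z / 2 * PSeries (PS_derive a) ((z / 2) ^ 2)).
Proof.
  intros H.
  apply (is_derive_comp (PSeries a) (fun t => (t / 2) ^ 2) z (PSeries (PS_derive a) ((z / 2) ^ 2)) (z / 2)).
  - now apply is_derive_entire.
  - auto_derive; [trivial|field].
Qed.

Lemma continuous_entire_sqr (a : nat -> R) (z : R) :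
  CV_radius a = p_infty -> continuous (fun t => PSeries a ((t / 2) ^ 2)) z.
Proof.
  intros H. apply (ex_derive_continuous (V := R_NormedModule)).
  eexists. now apply is_derive_entire_sqr.
Qed.

(** With [s = sqrt (k z)], the bound [ln (1 / s) < 1 / s] gives [- ln (k z) < 2 / s], so the product
    is at most [2 sqrt z / sqrt k] in absolute value. *)
Lemma lim_x_ln (k : R) : 0 < k ->
  filterlim (fun z => z * ln (k * z)) (at_right 0) (locally 0).
Proof.
  intros Hk. apply filterlim_locally. intros eps.
  (* Below [1 / k] the logarithm is negative; below the second bound [2 sqrt z / sqrt k] is less
     than [eps]. *)
  assert (He : 0 < Rmin (/ k) (Rsqr (eps * sqrt k / 2))).
  { apply Rmin_case; [now apply Rinv_0_lt_compat|]. apply Rlt_0_sqr.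
    pose proof (sqrt_lt_R0 k Hk). pose proof (cond_pos eps). nra. }
  exists (mkposreal _ He). intros z Hz Hz0.
  change (Rabs (z - 0) < Rmin (/ k) (Rsqr (eps * sqrt k / 2))) in Hz. rewrite Rminus_0_r, Rabs_pos_eq in Hz by lra.
  pose proof (Rlt_le_trans _ _ _ Hz (Rmin_l _ _)) as H1.
  pose proof (Rlt_le_trans _ _ _ Hz (Rmin_r _ _)) as H2.
  change (Rabs (z * ln (k * z) - 0) < eps). rewrite Rminus_0_r.
  assert (Hkz : 0 < k * z) by nra.
  assert (Hkz1 : k * z < 1).
  { apply Rmult_lt_reg_l with (/ k); [now apply Rinv_0_lt_compat|]. rewrite <- Rmult_assoc, Rinv_l by lra. lra. }
  set (s := sqrt (k * z)). assert (Hs : 0 < s) by now apply sqrt_lt_R0.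
  assert (Hss : s * s = k * z) by (apply sqrt_sqrt; lra).
  assert (Hln : - ln (k * z) < 2 * / s).
  { rewrite <- Hss, ln_mult by auto.
    assert (ln (/ s) < / s). { apply Rlt_le_trans with (/ s); [|lra].
      apply exp_lt_inv. rewrite exp_ln by now apply Rinv_0_lt_compat.
      pose proof (exp_ineq1 (/ s) ltac:(apply Rinv_neq_0_compat; lra)). lra. }
    rewrite ln_Rinv in H by auto. lra. }
  assert (ln (k * z) < 0) by (rewrite <- ln_1; apply ln_increasing; lra).
  rewrite Rabs_left by nra.
  assert (Hsk : sqrt k * sqrt k = k) by (apply sqrt_sqrt; lra).
  assert (Hk0 : 0 < sqrt k) by now apply sqrt_lt_R0.
  assert (Hz2 : sqrt z < eps * sqrt k / 2).
  { rewrite <- (sqrt_Rsqr (eps * sqrt k / 2)). apply sqrt_lt_1; lra.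
    pose proof (cond_pos eps). nra. }
  assert (Hs2 : s = sqrt k * sqrt z) by (apply sqrt_mult; lra).
  assert (Hz3 : sqrt z * sqrt z = z) by (apply sqrt_sqrt; lra).
  assert (0 < sqrt z) by now apply sqrt_lt_R0.
  apply Rlt_trans with (z * (2 * / s)); [nra|].
  replace (z * (2 * / s)) with (2 * sqrt z / sqrt k).
  2: { rewrite Hs2. rewrite <- Hz3 at 2. field. lra. }
  apply Rmult_lt_reg_r with (sqrt k); auto.
  replace (2 * sqrt z / sqrt k * sqrt k) with (2 * sqrt z) by (field; lra). lra.
Qed.

Lemma filterlim_at_right_0 (f : R -> R) (l : R) :
  continuous f 0 -> f 0 = l -> filterlim f (at_right 0) (locally l).
Proof.
  intros H <-. eapply filterlim_filter_le_1; [|exact H].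
  intros P HP. apply filter_le_within. exact HP.
Qed.

(** In this rule and the following ones the result is a free variable tied by an equation, so that
    they chain under [eapply] and leave the algebra to [ring] or [field]. *)
Lemma filterlim_Rplus {T} (F : (T -> Prop) -> Prop) {FF : Filter F} (f g : T -> R) (l m n : R) :
  filterlim f F (locally l) -> filterlim g F (locally m) -> l + m = n ->
  filterlim (fun x => f x + g x) F (locally n).
Proof.
  intros Hf Hg <-. eapply filterlim_comp_2; [exact Hf|exact Hg|].
  apply (filterlim_plus (K := R_AbsRing) (V := R_NormedModule)).
Qed.

Lemma filterlim_Rmult {T} (F : (T -> Prop) -> Prop) {FF : Filter F} (f g : T -> R) (l m n : R) :
  filterlim f F (locally l) -> filterlim g F (locally m) -> l * m = n ->
  filterlim (fun x => f x * g x) F (locally n).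
Proof.
  intros Hf Hg <-. eapply filterlim_comp_2; [exact Hf|exact Hg|].
  apply (filterlim_mult (K := R_AbsRing)).
Qed.

Lemma is_derive_Rplus (f g : R -> R) (x df dg d : R) :
  is_derive f x df -> is_derive g x dg -> df + dg = d ->
  is_derive (fun t => f t + g t) x d.
Proof. intros Hf Hg <-. exact (is_derive_plus (V := R_NormedModule) f g x df dg Hf Hg). Qed.

Lemma is_derive_Rminus (f g : R -> R) (x df dg d : R) :
  is_derive f x df -> is_derive g x dg -> df - dg = d ->
  is_derive (fun t => f t - g t) x d.
Proof. intros Hf Hg <-. exact (is_derive_minus (V := R_NormedModule) f g x df dg Hf Hg). Qed.

Lemma is_derive_Rmult (f g : R -> R) (x df dg d : R) :
  is_derive f x df -> is_derive g x dg -> df * g x + f x * dg = d ->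
  is_derive (fun t => f t * g t) x d.
Proof. intros Hf Hg <-. exact (is_derive_mult f g x df dg Hf Hg Rmult_comm). Qed.

Lemma is_derive_Rscal (k : R) (f : R -> R) (x df d : R) :
  is_derive f x df -> k * df = d -> is_derive (fun t => k * f t) x d.
Proof. intros Hf <-. exact (is_derive_scal f x k df Hf). Qed.

Lemma is_derive_Rcomp (f g : R -> R) (x df dg d : R) :
  is_derive f (g x) df -> is_derive g x dg -> dg * df = d ->
  is_derive (fun t => f (g t)) x d.
Proof. intros Hf Hg <-. exact (is_derive_comp (V := R_NormedModule) f g x df dg Hf Hg). Qed.

Lemma bessel_J_kernel : radial_kernel 0 (bessel_J 0) (bessel_J 1).
Proof.
  split.
  - intros z Hz. apply is_derive_ext with (fun z => PSeries (coef_J 0) ((z / 2) ^ 2)).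
    { intros t. rewrite bessel_J_PSeries. simpl. ring. }
    replace (- bessel_J 1 z) with (z / 2 * PSeries (PS_derive (coef_J 0)) ((z / 2) ^ 2)).
    + apply is_derive_entire_sqr, CV_radius_coef_J.
    + rewrite PS_derive_coef_J0, bessel_J_PSeries. simpl. ring.
  - intros z Hz.
    apply is_derive_ext with (fun z => z / 2 * PSeries (coef_J 1) ((z / 2) ^ 2)).
    { intros t. rewrite bessel_J_PSeries. simpl. ring. }
    rewrite !bessel_J_PSeries.
    replace ((z / 2) ^ 0 * PSeries (coef_J 0) ((z / 2) ^ 2) - (z / 2) ^ 1 * PSeries (coef_J 1) ((z / 2) ^ 2) / z) with
      (/ 2 * PSeries (coef_J 1) ((z / 2) ^ 2) + z / 2 * (z / 2 * PSeries (PS_derive (coef_J 1)) ((z / 2) ^ 2))).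
    + apply (is_derive_mult (fun z => z / 2) (fun z => PSeries (coef_J 1) ((z / 2) ^ 2)) z).
      * auto_derive; [trivial|field].
      * apply is_derive_entire_sqr, CV_radius_coef_J.
      * intros; apply Rmult_comm.
    + rewrite <- coef_J1_derive. field. lra.
  - apply (filterlim_ext (fun z => z / 2 * PSeries (coef_J 1) ((z / 2) ^ 2))).
    { intros z. rewrite bessel_J_PSeries. unfold Rdiv. ring. }
    apply filterlim_at_right_0; [|unfold Rdiv; ring].
    apply (continuous_mult (fun z => z / 2) (fun z => PSeries (coef_J 1) ((z / 2) ^ 2))).
    + apply (ex_derive_continuous (V := R_NormedModule)). auto_derive. trivial.
    + apply continuous_entire_sqr, CV_radius_coef_J.
  - apply (filterlim_ext (fun z => z * PSeries (coef_J 0) ((z / 2) ^ 2))).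
    { intros z. rewrite bessel_J_PSeries. simpl. ring. }
    apply filterlim_at_right_0; [|ring].
    apply (continuous_mult (fun z => z) (fun z => PSeries (coef_J 0) ((z / 2) ^ 2))).
    + apply continuous_id.
    + apply continuous_entire_sqr, CV_radius_coef_J.
Qed.

(** The constant is read off the pole [- 2 / (PI z)] of [Y_1]; what remains of [Y_1] is
    [z ln (z / 2)] and [z], each times a continuous function, and tends to 0. *)
Lemma bessel_Y_kernel : radial_kernel (2 / PI) (bessel_Y 0) (bessel_Y 1).
Proof.
  assert (HPI := PI_neq0).
  assert (Hln : forall z, 0 < z -> is_derive (fun t => ln (t / 2)) z (/ z)).
  { intros z Hz. auto_derive; [lra|]. field. lra. }
  assert (HA := fun n z => is_derive_entire_sqr (coef_J n) z (CV_radius_coef_J n)).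
  assert (HB := fun n z => is_derive_entire_sqr (coef_Y n) z (CV_radius_coef_Y n)).
  assert (HJ : forall n : nat, filterlim (fun t => PSeries (coef_J n) ((t / 2) ^ 2)) (at_right 0)
    (locally (PSeries (coef_J n) ((0 / 2) ^ 2)))).
  { intros n. now apply filterlim_at_right_0; [apply continuous_entire_sqr, CV_radius_coef_J|]. }
  assert (HY : forall n : nat, filterlim (fun t => PSeries (coef_Y n) ((t / 2) ^ 2)) (at_right 0)
    (locally (PSeries (coef_Y n) ((0 / 2) ^ 2)))).
  { intros n. now apply filterlim_at_right_0; [apply continuous_entire_sqr, CV_radius_coef_Y|]. }
  assert (Hid : filterlim (fun t : R => t) (at_right 0) (locally 0)).
  { apply filterlim_at_right_0; [apply continuous_id|reflexivity]. }
  assert (Hc : forall k : R, filterlim (fun t : R => k) (at_right 0) (locally k)) by (intros; apply filterlim_const).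
  pose proof (lim_x_ln (/ 2) ltac:(lra)) as Hxl.
  split.
  - intros z Hz.
    apply is_derive_ext with (fun z => 2 / PI * (ln (z / 2) * PSeries (coef_J 0) ((z / 2) ^ 2))
                 - / PI * PSeries (coef_Y 0) ((z / 2) ^ 2)).
    { intros t. rewrite bessel_Y0_PSeries. simpl. ring. }
    rewrite bessel_Y1_PSeries by auto.
    eapply is_derive_Rminus.
    + eapply is_derive_Rscal; [|reflexivity].
      eapply is_derive_Rmult; [exact (Hln z Hz)|exact (HA 0%nat z)|reflexivity].
    + eapply is_derive_Rscal; [exact (HB 0%nat z)|reflexivity].
    + simpl.
      rewrite PS_derive_coef_J0. pose proof (coef_Y0_derive ((z / 2) ^ 2)) as H. simpl in H.
      set (w := z / 2 * (z / 2 * 1)) in *.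
      (* The chain rule yields the factor [z / 2], whereas [coef_Y0_derive] needs the factor [w]. *)
      assert (Hw : z / 2 = 2 * w / z) by (unfold w; field; lra).
      replace (z / 2 * PSeries (PS_derive (coef_Y 0)) w) with (2 / z * (PSeries (coef_J 0) w - 1 - w * PSeries (coef_Y 1) w)).
      2: { rewrite Hw. transitivity (2 / z * (w * PSeries (PS_derive (coef_Y 0)) w)); [f_equal; lra | field; lra]. }
      rewrite Hw at 4. rewrite ?Hw. field. split; lra.
  - intros z Hz.
    apply is_derive_ext_loc with (fun z => 2 / PI * (ln (z / 2) * (z / 2 * PSeries (coef_J 1) ((z / 2) ^ 2)))
                 - / PI * (2 / z) - / PI * (z / 2 * PSeries (coef_Y 1) ((z / 2) ^ 2))).
    { exists (mkposreal z Hz). intros t Ht. change (Rabs (t - z) < z) in Ht. apply Rabs_def2 in Ht.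
      rewrite bessel_Y1_PSeries by lra. simpl. ring. }
    rewrite bessel_Y1_PSeries, bessel_Y0_PSeries by auto.
    assert (Hh : is_derive (fun t => t / 2) z (/ 2)) by (auto_derive; [trivial|field]).
    eapply is_derive_Rminus; [eapply is_derive_Rminus| |].
    + eapply is_derive_Rscal; [|reflexivity].
      eapply is_derive_Rmult; [exact (Hln z Hz)| |reflexivity].
      eapply is_derive_Rmult; [exact Hh|exact (HA 1%nat z)|reflexivity].
    + eapply is_derive_Rscal; [|reflexivity].
      instantiate (1 := - 2 / z ^ 2). auto_derive; [lra|]. field. lra.
    + reflexivity.
    + eapply is_derive_Rscal; [|reflexivity].
      eapply is_derive_Rmult; [exact Hh|exact (HB 1%nat z)|reflexivity].
    + simpl.
      pose proof (coef_J1_derive ((z / 2) ^ 2)) as H1. pose proof (coef_Y1_derive ((z / 2) ^ 2)) as H2. simpl in H1, H2.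
      set (w := z / 2 * (z / 2 * 1)) in *.
      replace (z / 2 * (z / 2 * PSeries (PS_derive (coef_J 1)) w)) with (w * PSeries (PS_derive (coef_J 1)) w) by (unfold w; field).
      replace (z / 2 * (z / 2 * PSeries (PS_derive (coef_Y 1)) w)) with (w * PSeries (PS_derive (coef_Y 1)) w) by (unfold w; field).
      replace (w * PSeries (PS_derive (coef_J 1)) w) with (PSeries (coef_J 0) w - PSeries (coef_J 1) w) by lra.
      replace (w * PSeries (PS_derive (coef_Y 1)) w) with (PSeries (coef_J 1) w + PSeries (coef_Y 0) w - PSeries (coef_Y 1) w) by lra.
      field. lra.
  - apply filterlim_within_ext with (fun z => / PI * (z * ln (/ 2 * z) * PSeries (coef_J 1) ((z / 2) ^ 2)) + / PI * (- / 2) * (z * PSeries (coef_Y 1) ((z / 2) ^ 2))).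
    { intros z Hz. rewrite bessel_Y1_PSeries by auto. rewrite (Rmult_comm (/ 2) z). fold (z / 2). field. lra. }
    apply (filterlim_Rplus (at_right 0) _ _ 0 0); [| |ring].
    + apply (filterlim_Rmult (at_right 0) _ _ (/ PI) 0); [apply Hc| |ring].
      eapply (filterlim_Rmult (at_right 0)); [exact Hxl|apply HJ|ring].
    + apply (filterlim_Rmult (at_right 0) _ _ (/ PI * (- / 2)) 0); [apply Hc| |ring].
      eapply (filterlim_Rmult (at_right 0)); [exact Hid|apply HY|ring].
  - apply filterlim_within_ext with (fun z => 2 / PI * (z * ln (/ 2 * z) * PSeries (coef_J 0) ((z / 2) ^ 2)) + (- / PI) * (z * PSeries (coef_Y 0) ((z / 2) ^ 2))).
    { intros z Hz. rewrite bessel_Y0_PSeries by auto. rewrite (Rmult_comm (/ 2) z). fold (z / 2). field. lra. }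
    apply (filterlim_Rplus (at_right 0) _ _ 0 0); [| |ring].
    + apply (filterlim_Rmult (at_right 0) _ _ (2 / PI) 0); [apply Hc| |ring].
      eapply (filterlim_Rmult (at_right 0)); [exact Hxl|apply HJ|ring].
    + apply (filterlim_Rmult (at_right 0) _ _ (- / PI) 0); [apply Hc| |ring].
      eapply (filterlim_Rmult (at_right 0)); [exact Hid|apply HY|ring].
Qed.

(** * The kernels on the line *)

(* [phi1], [phi2], [phi3] are the successive derivatives of [phi], which behaves
   like [c * ln |t|] at the origin. *)
Record log_kernel (c : R) (phi phi1 phi2 phi3 : R -> R) : Prop := {
  lk_derive0 : forall t, t <> 0 -> is_derive phi t (phi1 t);
  lk_derive1 : forall t, t <> 0 -> is_derive phi1 t (phi2 t);
  lk_derive2 : forall t, t <> 0 -> is_derive phi2 t (phi3 t);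
  lk_even0 : forall t, phi (- t) = phi t;
  lk_odd1 : forall t, phi1 (- t) = - phi1 t;
  lk_lim0 : filterlim (fun t => t * phi t) (locally' 0) (locally 0);
  lk_lim1 : filterlim (fun t => phi1 t - c / t) (locally' 0) (locally 0);
  lk_bound : forall L, exists C, 0 <= C /\ forall t, t <> 0 -> Rabs t <= L ->
    Rabs (t * phi1 t) <= C /\ Rabs (t ^ 2 * phi2 t) <= C /\ Rabs (t ^ 3 * phi3 t) <= C
}.

Definition line_kernel0 (k : R) (K0 : R -> R) (t : R) : R := K0 (k * Rabs t).

Definition line_kernel1 (k : R) (K1 : R -> R) (t : R) : R :=
  - (k * K1 (k * Rabs t)) * sign t.

(** The second derivative of [line_kernel0], already rewritten by Bessel's equation so that adding
    [k^2] times [line_kernel0] leaves the hypersingular kernel. *)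
Definition line_kernel2 (k : R) (K0 K1 : R -> R) (t : R) : R :=
  k * K1 (k * Rabs t) / Rabs t - k ^ 2 * K0 (k * Rabs t).

Definition line_kernel3 (k : R) (K0 K1 : R -> R) (t : R) : R :=
  (k ^ 3 * K1 (k * Rabs t) + k ^ 2 * K0 (k * Rabs t) / Rabs t
   - 2 * k * K1 (k * Rabs t) / Rabs t ^ 2) * sign t.

Lemma bounded_at_right (f : R -> R) (l : R) :
  (forall z, 0 < z -> continuous f z) -> filterlim f (at_right 0) (locally l) ->
  forall L, exists C, 0 <= C /\ forall z, 0 < z <= L -> Rabs (f z) <= C.
Proof.
  intros Hc Hl L.
  destruct (proj1 (filterlim_locally f l) Hl (mkposreal 1 Rlt_0_1)) as [d Hd].
  destruct (bounded_continuity f (d / 2) L) as [M HM].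
  { intros x Hx. apply Hc. pose proof (cond_pos d). lra. }
  exists (Rmax M (Rabs l + 1)). split.
  { eapply Rle_trans; [|apply Rmax_r]. pose proof (Rabs_pos l). lra. }
  intros z Hz. destruct (Rle_lt_dec (d / 2) z) as [H|H].
  - eapply Rle_trans; [|apply Rmax_l]. left. apply HM. lra.
  - eapply Rle_trans; [|apply Rmax_r].
    assert (Hb : ball 0 d z).
    { change (Rabs (z - 0) < d). rewrite Rminus_0_r, Rabs_pos_eq by lra. pose proof (cond_pos d). lra. }
    specialize (Hd z Hb (proj1 Hz)). change (Rabs (f z - l) < 1) in Hd.
    replace (f z) with (l + (f z - l)) by ring. eapply Rle_trans; [apply Rabs_triang|]. lra.
Qed.

Lemma is_derive_even (G : R -> R) (t d : R) : t <> 0 -> is_derive G (Rabs t) d ->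
  is_derive (fun s => G (Rabs s)) t (d * sign t).
Proof.
  intros Ht HG. eapply is_derive_Rcomp; [exact HG| |apply Rmult_comm].
  evar_last; [apply (is_derive_Rabs (fun s => s) t 1 (is_derive_id t) Ht)|]. apply Rmult_1_r.
Qed.

Lemma is_derive_odd (G : R -> R) (t d : R) : t <> 0 -> is_derive G (Rabs t) d ->
  is_derive (fun s => G (Rabs s) * sign s) t d.
Proof.
  intros Ht HG.
  apply is_derive_ext_loc with (fun s => G (Rabs s) * sign t).
  { exists (mkposreal _ (Rabs_pos_lt t Ht)). intros s Hs. change (Rabs (s - t) < Rabs t) in Hs.
    f_equal. destruct (Rdichotomy t 0 Ht).
    - rewrite (Rabs_left t) in Hs by lra. apply Rabs_def2 in Hs. rewrite !sign_eq_m1; lra.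
    - rewrite (Rabs_pos_eq t) in Hs by lra. apply Rabs_def2 in Hs. rewrite !sign_eq_1; lra. }
  apply is_derive_ext with (fun s => sign t * G (Rabs s)); [intros; apply Rmult_comm|].
  eapply is_derive_Rscal; [apply is_derive_even; [exact Ht|exact HG]|].
  destruct (Rdichotomy t 0 Ht); [rewrite sign_eq_m1 by lra|rewrite sign_eq_1 by lra]; ring.
Qed.

Lemma filterlim_locally'_0 (f : R -> R) (l : R) :
  filterlim f (at_right 0) (locally l) ->
  filterlim (fun t => f (Rabs t)) (locally' 0) (locally l).
Proof.
  intros H P HP. destruct (H P HP) as [d Hd]. exists d. intros t Ht Ht0.
  apply Hd; [|now apply Rabs_pos_lt].
  change (Rabs (Rabs t - 0) < d). rewrite Rminus_0_r, Rabs_Rabsolu.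
  change (Rabs (t - 0) < d) in Ht. now rewrite Rminus_0_r in Ht.
Qed.

Lemma at_right_scale (k : R) : 0 < k -> filterlim (fun z => k * z) (at_right 0) (at_right 0).
Proof.
  intros Hk P [d Hd]. assert (H : 0 < d / k) by (apply Rdiv_lt_0_compat; [apply cond_pos|auto]).
  exists (mkposreal _ H). intros z Hz Hz0. change (Rabs (z - 0) < d / k) in Hz.
  apply Hd; [|nra]. change (Rabs (k * z - 0) < d). rewrite Rminus_0_r in *.
  rewrite Rabs_mult, (Rabs_pos_eq k) by lra.
  replace (pos d) with (k * (d / k)) by (field; lra). now apply Rmult_lt_compat_l.
Qed.

Lemma Rabs_sign_le (t : R) : Rabs (sign t) <= 1.
Proof.
  destruct (Rtotal_order t 0) as [H|[H|H]].
  - rewrite sign_eq_m1 by auto. rewrite Rabs_m1. lra.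
  - rewrite H, sign_0, Rabs_R0. lra.
  - rewrite sign_eq_1 by auto. rewrite Rabs_R1. lra.
Qed.

Lemma sign_mul_Rabs (t : R) : sign t * Rabs t = t.
Proof.
  destruct (Rtotal_order t 0) as [H|[H|H]].
  - rewrite sign_eq_m1, Rabs_left by auto. ring.
  - rewrite H, sign_0. ring.
  - rewrite sign_eq_1, Rabs_pos_eq by lra. ring.
Qed.

Lemma line_log_kernel (c k : R) (K0 K1 : R -> R) : 0 < k -> radial_kernel c K0 K1 ->
  log_kernel c (line_kernel0 k K0) (line_kernel1 k K1) (line_kernel2 k K0 K1) (line_kernel3 k K0 K1).
Proof.
  intros Hk HK.
  assert (H0 : forall t, t <> 0 -> is_derive (fun s => K0 (k * s)) (Rabs t) (- (k * K1 (k * Rabs t)))).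
  { intros t Ht. eapply is_derive_Rcomp; [apply (rk_derive0 _ _ _ HK)| |].
    - apply Rmult_lt_0_compat; [auto|now apply Rabs_pos_lt].
    - auto_derive; [trivial|reflexivity].
    - ring. }
  assert (H1 : forall t, t <> 0 -> is_derive (fun s => K1 (k * s)) (Rabs t)
    (k * (K0 (k * Rabs t) - K1 (k * Rabs t) / (k * Rabs t)))).
  { intros t Ht. eapply is_derive_Rcomp; [apply (rk_derive1 _ _ _ HK)| |].
    - apply Rmult_lt_0_compat; [auto|now apply Rabs_pos_lt].
    - auto_derive; [trivial|reflexivity].
    - ring. }
  assert (HL1 : filterlim (fun z => z * K1 z) (at_right 0) (locally (- c))).
  { apply filterlim_within_ext with (fun z => z * (K1 z + c / z) + - c).
    { intros z Hz. field. lra. }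
    apply (filterlim_Rplus (at_right 0) _ _ 0 (- c)); [|apply filterlim_const|ring].
    apply (filterlim_Rmult (at_right 0) _ _ 0 0); [|apply (rk_lim1 _ _ _ HK)|ring].
    apply filterlim_at_right_0; [apply continuous_id|reflexivity]. }
  split.
  - intros t Ht. apply (is_derive_even (fun s => K0 (k * s)) t _ Ht (H0 t Ht)).
  - intros t Ht. apply (is_derive_odd (fun s => - (k * K1 (k * s)))); [exact Ht|].
    apply is_derive_ext with (fun s => - k * K1 (k * s)); [intros; simpl; ring|].
    eapply is_derive_Rscal; [apply H1, Ht|]. unfold line_kernel2.
    apply Rabs_no_R0 in Ht. field. lra.
  - intros t Ht. pose proof (Rabs_no_R0 t Ht) as Ht'.
    apply is_derive_ext with (fun s => (fun v => k * (K1 (k * v) * / v) - k ^ 2 * K0 (k * v)) (Rabs s)).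
    { intros s. unfold line_kernel2, Rdiv. simpl. ring. }
    apply (is_derive_even (fun v => k * (K1 (k * v) * / v) - k ^ 2 * K0 (k * v))); [exact Ht|].
    eapply is_derive_Rminus; [eapply is_derive_Rscal; [eapply is_derive_Rmult; [apply H1, Ht| |reflexivity]|reflexivity]
      |eapply is_derive_Rscal; [apply H0, Ht|reflexivity]|].
    + instantiate (1 := - / (Rabs t) ^ 2). auto_derive; [exact Ht'|]. field. exact Ht'.
    + field. split; lra.
  - intros t. unfold line_kernel0. now rewrite Rabs_Ropp.
  - intros t. unfold line_kernel1. rewrite Rabs_Ropp, sign_opp. ring.
  - apply filterlim_ext with (fun t => sign t * (/ k * (k * Rabs t * K0 (k * Rabs t)))).
    { intros t. unfold line_kernel0. rewrite <- (sign_mul_Rabs t) at 4. field. lra. }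
    assert (H : filterlim (fun t => / k * (k * Rabs t * K0 (k * Rabs t))) (locally' 0) (locally 0)).
    { apply (filterlim_locally'_0 (fun z => / k * (k * z * K0 (k * z)))).
      apply (filterlim_Rmult (at_right 0) _ _ (/ k) 0); [apply filterlim_const| |ring].
      apply (filterlim_comp _ _ _ (fun z => k * z) (fun z => z * K0 z) _ (at_right 0)).
      + now apply at_right_scale.
      + apply (rk_lim0 _ _ _ HK). }
    apply filterlim_locally. intros eps. apply filterlim_locally with (eps := eps) in H.
    eapply filter_imp; [|exact H]. intros t Ht.
    change (Rabs (/ k * (k * Rabs t * K0 (k * Rabs t)) - 0) < eps) in Ht.
    change (Rabs (sign t * (/ k * (k * Rabs t * K0 (k * Rabs t))) - 0) < eps).
    rewrite Rminus_0_r in *. rewrite Rabs_mult. pose proof (Rabs_sign_le t).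
    pose proof (Rabs_pos (/ k * (k * Rabs t * K0 (k * Rabs t)))). nra.
  - assert (H : filterlim (fun t => - k * (K1 (k * Rabs t) + c / (k * Rabs t))) (locally' 0) (locally 0)).
    { apply (filterlim_locally'_0 (fun z => - k * (K1 (k * z) + c / (k * z)))).
      apply (filterlim_Rmult (at_right 0) _ _ (- k) 0); [apply filterlim_const| |ring].
      apply (filterlim_comp _ _ _ (fun z => k * z) (fun z => K1 z + c / z) _ (at_right 0)).
      + now apply at_right_scale.
      + apply (rk_lim1 _ _ _ HK). }
    apply filterlim_locally. intros eps. apply filterlim_locally with (eps := eps) in H.
    destruct H as [d Hd]. exists d. intros t Ht Ht0. specialize (Hd t Ht Ht0).
    change (Rabs (- k * (K1 (k * Rabs t) + c / (k * Rabs t)) - 0) < eps) in Hd.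
    change (Rabs (line_kernel1 k K1 t - c / t - 0) < eps).
    replace (line_kernel1 k K1 t - c / t - 0) with
      (sign t * (- k * (K1 (k * Rabs t) + c / (k * Rabs t)) - 0)).
    + rewrite Rabs_mult. pose proof (Rabs_sign_le t).
      pose proof (Rabs_pos (- k * (K1 (k * Rabs t) + c / (k * Rabs t)) - 0)). nra.
    + unfold line_kernel1. destruct (Rdichotomy t 0 Ht0).
      * rewrite sign_eq_m1, Rabs_left by auto. field. lra.
      * rewrite sign_eq_1, Rabs_pos_eq by lra. field. lra.
  - intros L.
    destruct (bounded_at_right (fun z => z * K1 z) (- c)) with (L := k * L) as [C1 [HC1 B1]].
    { intros z Hz. apply (ex_derive_continuous (V := R_NormedModule)). eexists.
      eapply is_derive_Rmult; [apply is_derive_id|apply (rk_derive1 _ _ _ HK z Hz)|reflexivity]. }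
    { exact HL1. }
    destruct (bounded_at_right (fun z => z * K0 z) 0) with (L := k * L) as [C0 [HC0 B0]].
    { intros z Hz. apply (ex_derive_continuous (V := R_NormedModule)). eexists.
      eapply is_derive_Rmult; [apply is_derive_id|apply (rk_derive0 _ _ _ HK z Hz)|reflexivity]. }
    { apply (rk_lim0 _ _ _ HK). }
    (* With [z = k |t|], the three scaled derivatives are combinations of [z K1 z] and [z K0 z] with
       coefficients polynomial in [z], and [m] bounds [z]. [Rabs L] keeps [m] nonnegative when
       [L < 0], a case in which no [t] qualifies. *)
    set (m := k * Rabs L). assert (Hm : 0 <= m) by (apply Rmult_le_pos; [lra|apply Rabs_pos]).
    exists (2 * C1 + m * C0 + m ^ 2 * C1 + C0 * m). split; [pose proof (pow2_ge_0 m); nra|].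
    intros t Ht HtL. set (z := k * Rabs t).
    assert (Hz : 0 < z) by (apply Rmult_lt_0_compat; [auto|now apply Rabs_pos_lt]).
    assert (HzL : z <= k * L) by (apply Rmult_le_compat_l; lra).
    assert (Hzm : z <= m) by (eapply Rle_trans; [exact HzL|apply Rmult_le_compat_l; [lra|apply Rle_abs]]).
    specialize (B1 z (conj Hz HzL)). specialize (B0 z (conj Hz HzL)). cbv beta in B1, B0.
    pose proof (Rabs_no_R0 t Ht) as Ht'.
    assert (Hz2 : z ^ 2 <= m ^ 2) by (apply pow_incr; lra).
    assert (P1 := Rabs_pos (z * K1 z)). assert (P0 := Rabs_pos (z * K0 z)).
    assert (Hss : Rabs t ^ 2 = t ^ 2) by apply pow2_abs.
    assert (Q1 : Rabs (z ^ 2 * (z * K1 z)) <= m ^ 2 * C1).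
    { rewrite Rabs_mult, (Rabs_pos_eq (z ^ 2)) by apply pow2_ge_0. apply Rmult_le_compat; auto. apply pow2_ge_0. }
    assert (Q0 : Rabs (z * (z * K0 z)) <= m * C0).
    { rewrite Rabs_mult, (Rabs_pos_eq z) by lra. apply Rmult_le_compat; auto. lra. }
    assert (Hm1 : 0 <= m ^ 2 * C1) by (pose proof (pow2_ge_0 m); nra).
    assert (Hm0 : 0 <= m * C0) by nra.
    repeat split.
    + replace (t * line_kernel1 k K1 t) with (- (z * K1 z)).
      * rewrite Rabs_Ropp. lra.
      * unfold line_kernel1. fold z. rewrite <- (sign_mul_Rabs t) at 1. unfold z at 1.
        destruct (Rdichotomy t 0 Ht); [rewrite sign_eq_m1 by auto|rewrite sign_eq_1 by auto]; ring.
    + replace (t ^ 2 * line_kernel2 k K0 K1 t) with (z * K1 z - z * (z * K0 z)).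
      * eapply Rle_trans; [apply Rabs_triang|]. rewrite Rabs_Ropp. lra.
      * unfold line_kernel2. fold z. rewrite <- Hss. unfold z at 1 3 4. field. auto.
    + replace (t ^ 3 * line_kernel3 k K0 K1 t) with (z ^ 2 * (z * K1 z) + z * (z * K0 z) - 2 * (z * K1 z)).
      * eapply Rle_trans; [apply Rabs_triang|]. rewrite Rabs_Ropp.
        pose proof (Rabs_triang (z ^ 2 * (z * K1 z)) (z * (z * K0 z))).
        rewrite (Rabs_mult 2), (Rabs_pos_eq 2) by lra. lra.
      * unfold line_kernel3. fold z. replace (t ^ 3) with (Rabs t ^ 2 * (sign t * Rabs t)).
        2: { rewrite sign_mul_Rabs, Hss. ring. }
        unfold z at 1 2 4 5 7.
        destruct (Rdichotomy t 0 Ht); [rewrite sign_eq_m1 by auto|rewrite sign_eq_1 by auto]; field; auto.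
Qed.

(** * Integration by parts against a logarithmic kernel *)

Lemma is_derive_difference_quotient (f : R -> R) (x l : R) :
  is_derive f x l <-> filterlim (fun h => (f (x + h) - f x) / h) (locally' 0) (locally l).
Proof.
  rewrite is_derive_Reals. split.
  - intros H. apply filterlim_locally. intros eps. destruct (H eps (cond_pos eps)) as [d Hd].
    exists d. intros h Hh Hh0. change (Rabs (h - 0) < d) in Hh. rewrite Rminus_0_r in Hh.
    exact (Hd h Hh0 Hh).
  - intros H eps Heps. apply filterlim_locally with (eps := mkposreal eps Heps) in H.
    destruct H as [d Hd]. exists d. intros h Hh0 Hh. apply Hd; [|exact Hh0].
    change (Rabs (h - 0) < d). now rewrite Rminus_0_r.
Qed.

Lemma filterlim_locally'_shift (s : R) : filterlim (fun y => y - s) (locally' s) (locally' 0).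
Proof.
  intros P [d Hd]. exists d. intros y Hy Hys. apply Hd; [|lra].
  change (Rabs (y - s - 0) < d). rewrite Rminus_0_r. exact Hy.
Qed.

Lemma filterlim_locally'_reflect (s : R) : filterlim (fun y => s - y) (locally' s) (locally' 0).
Proof.
  intros P [d Hd]. exists d. intros y Hy Hys. apply Hd; [|lra].
  change (Rabs (s - y - 0) < d). rewrite Rminus_0_r, Rabs_minus_sym. exact Hy.
Qed.

Lemma continuous_locally' (f : R -> R) (x : R) :
  filterlim f (locally' x) (locally (f x)) -> continuous f x.
Proof.
  intros H P HP. destruct (H P HP) as [d Hd]. exists d. intros y Hy.
  destruct (Req_dec y x) as [->|Hyx]; [now apply locally_singleton|now apply Hd].
Qed.

Lemma filterlim_at_left_locally' (f : R -> R) (x : R) (G : (R -> Prop) -> Prop) :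
  filterlim f (locally' x) G -> filterlim f (at_left x) G.
Proof.
  intros H P HP. destruct (H P HP) as [d Hd]. exists d. intros y Hy Hyx. apply Hd; [exact Hy|lra].
Qed.

Lemma filterlim_at_right_locally' (f : R -> R) (x : R) (G : (R -> Prop) -> Prop) :
  filterlim f (locally' x) G -> filterlim f (at_right x) G.
Proof.
  intros H P HP. destruct (H P HP) as [d Hd]. exists d. intros y Hy Hyx. apply Hd; [exact Hy|lra].
Qed.

Lemma continuous_locally'_filterlim (f : R -> R) (x : R) :
  continuous f x -> filterlim f (locally' x) (locally (f x)).
Proof.
  intros H P HP. destruct (H P HP) as [d Hd]. exists d. intros y Hy _. now apply Hd.
Qed.

Lemma is_derive_continuous (f : R -> R) (x l : R) : is_derive f x l -> continuous f x.
Proof. intros H. apply (ex_derive_continuous (V := R_NormedModule)). now exists l. Qed.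

Lemma continuous_reflect (f : R -> R) (s y : R) :
  continuous f (s - y) -> continuous (fun v => f (s - v)) y.
Proof.
  intros H. apply (continuous_comp (fun v => s - v) f); [|exact H].
  eapply is_derive_continuous. auto_derive; [trivial|reflexivity].
Qed.

Lemma is_derive_reflect (f : R -> R) (s y d : R) :
  is_derive f (s - y) d -> is_derive (fun v => f (s - v)) y (- d).
Proof.
  intros H. eapply is_derive_Rcomp; [exact H| |].
  - auto_derive; [trivial|reflexivity].
  - ring.
Qed.

(* The product [(p y - p s) * phi1 (s - y)], extended continuously to [y = s]. *)
Definition log_quotient (c : R) (phi1 p : R -> R) (qs s y : R) : R :=
  if Req_EM_T y s then - (c * qs) else (p y - p s) * phi1 (s - y).

(** On either side of [s], an antiderivative of [p' (y) phi (s - y)]: integration by parts with the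
    constant [p s] subtracted, so that the boundary term vanishes at the singularity. *)
Definition log_primitive (c : R) (phi phi1 p : R -> R) (qs s y : R) : R :=
  (p y - p s) * phi (s - y) + RInt (log_quotient c phi1 p qs s) s y.

Lemma log_kernel_lim_mul (c : R) (phi phi1 phi2 phi3 : R -> R) :
  log_kernel c phi phi1 phi2 phi3 ->
  filterlim (fun t => t * phi1 t) (locally' 0) (locally c).
Proof.
  intros HK.
  assert (H : filterlim (fun t => t * (phi1 t - c / t) + c) (locally' 0) (locally c)).
  { apply (filterlim_Rplus (locally' 0) _ _ 0 c); [|apply filterlim_const|ring].
    apply (filterlim_Rmult (locally' 0) _ _ 0 0); [|apply (lk_lim1 _ _ _ _ _ HK)|ring].
    apply (continuous_locally'_filterlim (fun t => t)), continuous_id. }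
  intros P HP. destruct (H P HP) as [d Hd]. exists d. intros t Ht Ht0.
  specialize (Hd t Ht Ht0). replace (t * phi1 t) with (t * (phi1 t - c / t) + c); [exact Hd|].
  field. exact Ht0.
Qed.

Lemma difference_quotient_lim (p : R -> R) (s qs : R) : is_derive p s qs ->
  filterlim (fun y => (p y - p s) / (y - s)) (locally' s) (locally qs).
Proof.
  intros H. apply is_derive_difference_quotient in H.
  apply filterlim_ext with (fun y => (fun h => (p (s + h) - p s) / h) (y - s)).
  { intros y. cbv beta. now replace (s + (y - s)) with y by ring. }
  apply (filterlim_comp _ _ _ (fun y => y - s) (fun h => (p (s + h) - p s) / h) _ (locally' 0)); [apply filterlim_locally'_shift|exact H].
Qed.

Lemma continuous_log_quotient (c : R) (phi phi1 phi2 phi3 p : R -> R) (qs s y : R) :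
  log_kernel c phi phi1 phi2 phi3 -> continuous p y -> is_derive p s qs ->
  continuous (log_quotient c phi1 p qs s) y.
Proof.
  intros HK Hp Hs. destruct (Req_dec y s) as [->|Hys].
  - apply continuous_locally'. unfold log_quotient at 2. destruct (Req_EM_T s s); [|easy].
    (* The difference quotient tends to [qs] and [t phi1 t] to [c]; this is the origin of the
       diagonal value in [log_quotient]. *)
    assert (H : filterlim (fun y => (p y - p s) / (y - s) * (- ((s - y) * phi1 (s - y)))) (locally' s)
      (locally (- (c * qs)))).
    { apply (filterlim_Rmult (locally' s) _ _ qs (- c)); [now apply difference_quotient_lim| |ring].
      apply (filterlim_comp _ _ _ (fun y => (s - y) * phi1 (s - y)) Ropp _ (locally c)).
      - apply (filterlim_comp _ _ _ (fun y => s - y) (fun t => t * phi1 t) _ (locally' 0)).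
        + apply filterlim_locally'_reflect.
        + now apply (log_kernel_lim_mul c phi phi1 phi2 phi3).
      - apply (filterlim_opp (V := R_NormedModule)). }
    intros P HP. destruct (H P HP) as [d Hd]. exists d. intros y Hy Hys.
    specialize (Hd y Hy Hys). unfold log_quotient. destruct (Req_EM_T y s); [easy|].
    replace ((p y - p s) * phi1 (s - y)) with ((p y - p s) / (y - s) * - ((s - y) * phi1 (s - y))); [exact Hd|].
    field. lra.
  - assert (Hd : 0 < Rabs (y - s)) by (apply Rabs_pos_lt; lra).
    apply continuous_ext_loc with (fun y => (p y - p s) * phi1 (s - y)).
    { exists (mkposreal _ Hd). intros z Hz. change (Rabs (z - y) < Rabs (y - s)) in Hz.
      unfold log_quotient. destruct (Req_EM_T z s) as [->|]; [|easy].
      rewrite Rabs_minus_sym in Hz. lra. }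
    apply (continuous_mult (fun y => p y - p s) (fun y => phi1 (s - y))).
    + apply (continuous_minus p (fun _ => p s)); [exact Hp|apply continuous_const].
    + apply continuous_reflect. eapply is_derive_continuous, (lk_derive1 _ _ _ _ _ HK). lra.
Qed.

Lemma ex_RInt_continuous_everywhere (f : R -> R) (a b : R) : (forall y, continuous f y) -> ex_RInt f a b.
Proof. intros H. apply (ex_RInt_continuous (V := R_CompleteNormedModule)). auto. Qed.

Lemma is_derive_RInt_continuous (f : R -> R) (a y : R) : (forall z, continuous f z) ->
  is_derive (RInt f a) y (f y).
Proof.
  intros H. apply (is_derive_RInt (V := R_NormedModule) f (RInt f a) a); [|apply H].
  apply filter_forall. intros z. apply (RInt_correct (V := R_CompleteNormedModule)), ex_RInt_continuous_everywhere, H.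
Qed.

Lemma is_derive_log_primitive (c : R) (phi phi1 phi2 phi3 p : R -> R) (qs s y qy : R) :
  log_kernel c phi phi1 phi2 phi3 -> (forall z, continuous p z) -> is_derive p s qs ->
  y <> s -> is_derive p y qy ->
  is_derive (log_primitive c phi phi1 p qs s) y (qy * phi (s - y)).
Proof.
  intros HK Hp Hs Hys Hy. unfold log_primitive.
  eapply is_derive_Rplus.
  - eapply is_derive_Rmult; [|apply is_derive_reflect, (lk_derive0 _ _ _ _ _ HK); lra|reflexivity].
    eapply is_derive_Rminus; [exact Hy|exact (is_derive_const (V := R_NormedModule) (p s) y : is_derive (fun _ => p s) y 0)|reflexivity].
  - apply is_derive_RInt_continuous. intros z. now apply (continuous_log_quotient c phi phi1 phi2 phi3).
  - unfold log_quotient. destruct (Req_EM_T y s); [easy|]. simpl. ring.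
Qed.

(** The boundary term is a difference quotient of [p] times [t phi t], which tends to 0. Hence only
    [a] and [b] contribute to the improper integrals on the two sides of [s]. *)
Lemma log_primitive_lim (c : R) (phi phi1 phi2 phi3 p : R -> R) (qs s : R) :
  log_kernel c phi phi1 phi2 phi3 -> (forall z, continuous p z) -> is_derive p s qs ->
  filterlim (log_primitive c phi phi1 p qs s) (locally' s) (locally 0).
Proof.
  intros HK Hp Hs. unfold log_primitive.
  apply (filterlim_Rplus (locally' s) _ _ 0 0); [| |ring].
  - assert (H : filterlim (fun y => (p y - p s) / (y - s) * (- ((s - y) * phi (s - y)))) (locally' s) (locally 0)).
    { apply (filterlim_Rmult (locally' s) _ _ qs (- 0)); [now apply difference_quotient_lim| |ring].
      apply (filterlim_comp _ _ _ (fun y => (s - y) * phi (s - y)) Ropp _ (locally 0)).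
      - apply (filterlim_comp _ _ _ (fun y => s - y) (fun t => t * phi t) _ (locally' 0)).
        + apply filterlim_locally'_reflect.
        + apply (lk_lim0 _ _ _ _ _ HK).
      - apply (filterlim_opp (V := R_NormedModule)). }
    intros P HP. destruct (H P HP) as [d Hd]. exists d. intros y Hy Hys.
    specialize (Hd y Hy Hys).
    replace ((p y - p s) * phi (s - y)) with ((p y - p s) / (y - s) * - ((s - y) * phi (s - y))); [exact Hd|].
    field. lra.
  - assert (E0 : RInt (log_quotient c phi1 p qs s) s s = 0) by exact (RInt_point s _).
    rewrite <- E0.
    apply (continuous_locally'_filterlim (RInt (log_quotient c phi1 p qs s) s)).
    eapply is_derive_continuous, is_derive_RInt_continuous.
    intros z. now apply (continuous_log_quotient c phi phi1 phi2 phi3).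
Qed.

Lemma is_RInt_primitive (N f : R -> R) (u v : R) : u <= v ->
  (forall y, u <= y <= v -> is_derive N y (f y)) ->
  (forall y, u <= y <= v -> continuous f y) -> is_RInt f u v (N v - N u).
Proof.
  intros Huv HN Hf. apply (is_RInt_derive (V := R_CompleteNormedModule) N f u v);
    rewrite Rmin_left, Rmax_right by lra; auto.
Qed.

Lemma is_RInt_gen_primitive (N f : R -> R) (a b la lb : R) : a < b ->
  (forall y, a < y < b -> is_derive N y (f y)) ->
  (forall y, a < y < b -> continuous f y) ->
  filterlim N (at_right a) (locally la) -> filterlim N (at_left b) (locally lb) ->
  is_RInt_gen f (at_right a) (at_left b) (lb - la).
Proof.
  intros Hab HN Hf Ha Hb P HP.
  assert (H : filterlim (fun uv : R * R => N (snd uv) - N (fst uv))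
    (filter_prod (at_right a) (at_left b)) (locally (lb - la))).
  { apply (filterlim_Rplus (filter_prod (at_right a) (at_left b))
      (fun uv => N (snd uv)) (fun uv => - N (fst uv)) lb (- la)); [| |ring].
    - apply (filterlim_comp _ _ _ snd N _ (at_left b)); [apply filterlim_snd|exact Hb].
    - apply (filterlim_comp _ _ _ fst (fun u => - N u) _ (at_right a)); [apply filterlim_fst|].
      apply (filterlim_comp _ _ _ N Ropp _ (locally la)); [exact Ha|].
      apply (filterlim_opp (V := R_NormedModule)). }
  (* Keeping the two end points on opposite sides of the midpoint ensures their order, as
     [is_RInt_primitive] demands. *)
  assert (Hd : 0 < (b - a) / 2) by lra.
  assert (Hu : at_right a (fun u => a < u < (a + b) / 2)).
  { exists (mkposreal _ Hd). intros u Hd' Hau. change (Rabs (u - a) < (b - a) / 2) in Hd'.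
    apply Rabs_def2 in Hd'. lra. }
  assert (Hv : at_left b (fun v => (a + b) / 2 < v < b)).
  { exists (mkposreal _ Hd). intros u Hd' Hau. change (Rabs (u - b) < (b - a) / 2) in Hd'.
    apply Rabs_def2 in Hd'. lra. }
  specialize (H P HP). unfold filtermap in H.
  assert (Huv := Filter_prod _ _ (fun uv => (a < fst uv < (a + b) / 2) /\ ((a + b) / 2 < snd uv < b)) _ _ Hu Hv (fun u v H1 H2 => conj H1 H2)).
  pose proof (filter_and _ _ H Huv) as H2. unfold filtermapi. revert H2. apply filter_imp.
  intros [u v] [HP' [Hu' Hv']]. simpl in *. exists (N v - N u). split; [|exact HP'].
  apply is_RInt_primitive; [lra| |]; intros y Hy; [apply HN|apply Hf]; lra.
Qed.

(** Used with [p] the trace, for the potential of its derivative, and with [p] an antiderivative of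
    the trace, for the weakly singular integral. Continuity of [p] alone controls the edges, where
    nothing is assumed on [q]. *)
Lemma log_integral (c : R) (phi phi1 phi2 phi3 p q : R -> R) (a s b : R) :
  log_kernel c phi phi1 phi2 phi3 -> (forall z, continuous p z) -> a < s < b ->
  (forall y, a < y < b -> is_derive p y (q y)) ->
  (forall y, a < y < b -> continuous q y) ->
  let N := log_primitive c phi phi1 p (q s) s in
  is_RInt_gen (fun y => q y * phi (s - y)) (at_right a) (at_left s) (- N a) /\
  is_RInt_gen (fun y => q y * phi (s - y)) (at_right s) (at_left b) (N b).
Proof.
  intros HK Hp Hs Hpq Hq N.
  assert (HN : forall y, a < y < b -> y <> s -> is_derive N y (q y * phi (s - y))).
  { intros y Hy Hys. apply (is_derive_log_primitive c phi phi1 phi2 phi3); auto. }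
  assert (Hc : forall y, a < y < b -> y <> s -> continuous (fun y => q y * phi (s - y)) y).
  { intros y Hy Hys. apply (continuous_mult q (fun y => phi (s - y))); [auto|].
    apply continuous_reflect. eapply is_derive_continuous, (lk_derive0 _ _ _ _ _ HK). lra. }
  assert (Hend : forall y, y <> s -> continuous N y).
  { intros y Hy. apply (continuous_plus (fun y => (p y - p s) * phi (s - y)) (RInt (log_quotient c phi1 p (q s) s) s)).
    - apply (continuous_mult (fun y => p y - p s) (fun y => phi (s - y))).
      + apply (continuous_minus p (fun _ => p s)); [apply Hp|apply continuous_const].
      + apply continuous_reflect. eapply is_derive_continuous, (lk_derive0 _ _ _ _ _ HK). lra.
    - eapply is_derive_continuous, is_derive_RInt_continuous.
      intros z. apply (continuous_log_quotient c phi phi1 phi2 phi3); auto. }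
  assert (H0 : filterlim N (locally' s) (locally 0)).
  { apply (log_primitive_lim c phi phi1 phi2 phi3); auto. }
  split.
  - replace (- N a) with (0 - N a) by ring.
    apply (is_RInt_gen_primitive N); [lra| | | |].
    + intros y Hy. apply HN; lra.
    + intros y Hy. apply Hc; lra.
    + apply filterlim_at_right_locally', continuous_locally'_filterlim, Hend. lra.
    + now apply filterlim_at_left_locally'.
  - replace (N b) with (N b - 0) by ring.
    apply (is_RInt_gen_primitive N); [lra| | | |].
    + intros y Hy. apply HN; lra.
    + intros y Hy. apply Hc; lra.
    + now apply filterlim_at_right_locally'.
    + apply filterlim_at_left_locally', continuous_locally'_filterlim, Hend. lra.
Qed.

Lemma log_primitive_diff (c : R) (phi phi1 phi2 phi3 p : R -> R) (qs s a b : R) :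
  log_kernel c phi phi1 phi2 phi3 -> (forall z, continuous p z) -> is_derive p s qs ->
  log_primitive c phi phi1 p qs s b - log_primitive c phi phi1 p qs s a
  = (p b - p s) * phi (s - b) - (p a - p s) * phi (s - a)
    + RInt (log_quotient c phi1 p qs s) a b.
Proof.
  intros HK Hp Hs. unfold log_primitive.
  assert (Hc : forall z, continuous (log_quotient c phi1 p qs s) z).
  { intros z. now apply (continuous_log_quotient c phi phi1 phi2 phi3). }
  rewrite <- (RInt_Chasles (V := R_CompleteNormedModule) (log_quotient c phi1 p qs s) s a b)
    by now apply ex_RInt_continuous_everywhere.
  unfold plus; simpl. ring.
Qed.

(** * Taylor estimates away from the singularity *)

Lemma mean_value (f df : R -> R) (u v : R) :
  (forall y, Rmin u v <= y <= Rmax u v -> is_derive f y (df y)) ->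
  exists z, Rmin u v <= z <= Rmax u v /\ f v - f u = df z * (v - u).
Proof.
  intros H. apply (MVT_gen f u v df).
  - intros y Hy. apply H. lra.
  - intros y Hy. apply continuity_pt_filterlim. eapply is_derive_continuous, H, Hy.
Qed.

Lemma Rabs_between (t h z : R) : Rmin t (t + h) <= z <= Rmax t (t + h) -> Rabs (z - t) <= Rabs h.
Proof.
  unfold Rmin, Rmax. destruct (Rle_dec t (t + h)); intros Hz.
  - rewrite (Rabs_pos_eq h), Rabs_pos_eq; lra.
  - rewrite (Rabs_left h), Rabs_left1; lra.
Qed.

Lemma Rabs_ge_half (t z h : R) : 2 * Rabs h <= Rabs t -> Rabs (z - t) <= Rabs h -> Rabs t / 2 <= Rabs z.
Proof.
  intros Ht Hz. pose proof (Rabs_triang z (t - z)). rewrite (Rabs_minus_sym t z) in H.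
  replace (z + (t - z)) with t in H by ring. lra.
Qed.

(** Two applications of the mean value theorem leave [phi3 w] times a difference of size at most
    [|h|]. Since [|w| >= |t| / 2], the bound [C / |w|^3] costs the factor 8. *)
Lemma log_kernel_taylor (c L C t h : R) (phi phi1 phi2 phi3 : R -> R) :
  log_kernel c phi phi1 phi2 phi3 ->
  (forall t, t <> 0 -> Rabs t <= L -> Rabs (t ^ 3 * phi3 t) <= C) ->
  h <> 0 -> 2 * Rabs h <= Rabs t -> Rabs t + Rabs h <= L ->
  Rabs (phi2 t - (phi1 (t + h) - phi1 t) / h) <= 8 * C * Rabs h / Rabs t ^ 3.
Proof.
  intros HK HC Hh Hth HtL.
  assert (Hh' := Rabs_pos_lt h Hh).
  assert (Hnz : forall z, Rabs (z - t) <= Rabs h -> z <> 0).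
  { intros z Hz ->. apply Rabs_ge_half in Hz; [|exact Hth]. rewrite Rabs_R0 in Hz. lra. }
  destruct (mean_value phi1 phi2 t (t + h)) as [z [Hz Ez]].
  { intros y Hy. apply (lk_derive1 _ _ _ _ _ HK), Hnz, Rabs_between, Hy. }
  apply Rabs_between in Hz.
  assert (Hzw : forall w, Rmin t z <= w <= Rmax t z -> Rabs (w - t) <= Rabs h).
  { intros w Hw. apply Rle_trans with (Rabs (z - t)); [|exact Hz].
    apply Rabs_between. now replace (t + (z - t)) with z by ring. }
  destruct (mean_value phi2 phi3 t z) as [w [Hw Ew]].
  { intros y Hy. apply (lk_derive2 _ _ _ _ _ HK), Hnz, Hzw, Hy. }
  apply Hzw in Hw.
  replace (phi2 t - (phi1 (t + h) - phi1 t) / h) with (- (phi3 w * (z - t))).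
  2: { rewrite <- Ew, Ez. field. exact Hh. }
  rewrite Rabs_Ropp, Rabs_mult.
  assert (Hwt := Rabs_ge_half t w h Hth Hw).
  assert (HwL : Rabs w <= L).
  { pose proof (Rabs_triang t (w - t)). replace (t + (w - t)) with w in H by ring. lra. }
  specialize (HC w (Hnz w Hw) HwL). rewrite Rabs_mult, <- RPow_abs in HC.
  assert (Ht : 0 < Rabs t) by lra.
  assert (Hw3 : (Rabs t / 2) ^ 3 <= Rabs w ^ 3) by (apply pow_incr; lra).
  assert (Ht3 : 0 < Rabs t ^ 3) by now apply pow_lt.
  pose proof (Rabs_pos (phi3 w)) as Hp.
  apply Rle_trans with (Rabs (phi3 w) * Rabs h); [now apply Rmult_le_compat_l|].
  apply Rmult_le_reg_r with (Rabs t ^ 3); [exact Ht3|].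
  replace (8 * C * Rabs h / Rabs t ^ 3 * Rabs t ^ 3) with (8 * C * Rabs h) by (field; lra).
  replace ((Rabs t / 2) ^ 3) with (Rabs t ^ 3 / 8) in Hw3 by field.
  assert (Rabs (phi3 w) * (Rabs t ^ 3 / 8) <= C).
  { eapply Rle_trans; [|exact HC]. rewrite Rmult_comm. now apply Rmult_le_compat_r. }
  nra.
Qed.

Lemma is_RInt_inv_sqr (x u v : R) : u <= v -> (forall y, u <= y <= v -> y <> x) ->
  is_RInt (fun y => / (y - x) ^ 2) u v (/ (u - x) - / (v - x)).
Proof.
  intros Huv Hx.
  replace (/ (u - x) - / (v - x)) with (- / (v - x) - - / (u - x)) by ring.
  apply (is_RInt_primitive (fun y => - / (y - x))); [exact Huv| |].
  - intros y Hy. specialize (Hx y Hy). auto_derive; [lra|]. field. lra.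
  - intros y Hy. specialize (Hx y Hy). apply (ex_derive_continuous (V := R_NormedModule)).
    auto_derive. assert ((y - x) <> 0) by lra. change (((y - x) ^ 2) <> 0). now apply pow_nonzero.
Qed.

(** The left-hand side is the integral of [1 / (y - x)^2] over [[u, v]]; the end point nearer to [x]
    dominates it. *)
Lemma RInt_inv_sqr_bound (x u v d : R) : 0 < d -> u <= v ->
  x + d <= u \/ v <= x - d -> / (u - x) - / (v - x) <= / d.
Proof.
  intros Hd Huv [H|H].
  - assert (/ (u - x) <= / d) by (apply Rinv_le_contravar; lra).
    assert (0 < / (v - x)) by (apply Rinv_0_lt_compat; lra). lra.
  - assert (/ (x - v) <= / d) by (apply Rinv_le_contravar; lra).
    assert (0 < / (x - u)) by (apply Rinv_0_lt_compat; lra).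
    replace (u - x) with (- (x - u)) by ring. replace (v - x) with (- (x - v)) by ring.
    rewrite !Rinv_opp. lra.
Qed.

Lemma RInt_abs_bound (f : R -> R) (u v M : R) : u <= v ->
  (forall y, u <= y <= v -> continuous f y) ->
  (forall y, u <= y <= v -> Rabs (f y) <= M) -> Rabs (RInt f u v) <= (v - u) * M.
Proof.
  intros Huv Hc HM. apply abs_RInt_le_const; auto.
  apply (ex_RInt_continuous (V := R_CompleteNormedModule)). now rewrite Rmin_left, Rmax_right by lra.
Qed.

Lemma continuous_kernel1 (c : R) (phi phi1 phi2 phi3 : R -> R) (s y : R) :
  log_kernel c phi phi1 phi2 phi3 -> y <> s -> continuous (fun y => phi1 (s - y)) y.
Proof.
  intros HK Hy. apply continuous_reflect. eapply is_derive_continuous, (lk_derive1 _ _ _ _ _ HK). lra.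
Qed.

Lemma continuous_kernel2 (c : R) (phi phi1 phi2 phi3 : R -> R) (s y : R) :
  log_kernel c phi phi1 phi2 phi3 -> y <> s -> continuous (fun y => phi2 (s - y)) y.
Proof.
  intros HK Hy. apply continuous_reflect. eapply is_derive_continuous, (lk_derive2 _ _ _ _ _ HK). lra.
Qed.

Lemma RInt_kernel1 (c : R) (phi phi1 phi2 phi3 : R -> R) (s u v : R) :
  log_kernel c phi phi1 phi2 phi3 -> u <= v -> (forall y, u <= y <= v -> y <> s) ->
  RInt (fun y => phi1 (s - y)) u v = phi (s - u) - phi (s - v).
Proof.
  intros HK Huv Hs. apply (is_RInt_unique (V := R_CompleteNormedModule)).
  replace (phi (s - u) - phi (s - v)) with (- phi (s - v) - - phi (s - u)) by ring.
  apply (is_RInt_primitive (fun y => - phi (s - y))); [exact Huv| |].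
  - intros y Hy. specialize (Hs y Hy). apply is_derive_ext with (fun y => -1 * phi (s - y)); [intros; simpl; ring|].
    eapply is_derive_Rscal; [apply is_derive_reflect, (lk_derive0 _ _ _ _ _ HK); lra|]. ring.
  - intros y Hy. apply (continuous_kernel1 c phi phi1 phi2 phi3); auto.
Qed.

(* The integrand of the finite part minus the difference quotient of the
   integrand of the single layer potential, on one side of the singularity. *)
Lemma outer_estimate (c L C eta M delta h x u v : R) (phi phi1 phi2 phi3 r : R -> R) :
  log_kernel c phi phi1 phi2 phi3 ->
  (forall t, t <> 0 -> Rabs t <= L -> Rabs (t ^ 3 * phi3 t) <= C) ->
  h <> 0 -> u <= v -> x + 2 * Rabs h <= u \/ v <= x - 2 * Rabs h ->
  (forall y, u <= y <= v -> Rabs (x - y) + Rabs h <= L) ->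
  (forall y, continuous r y) ->
  0 <= C -> 0 <= eta -> 0 < delta ->
  (forall y, u <= y <= v -> Rabs (r y) <= M) ->
  (forall y, Rabs (y - x) <= delta -> Rabs (r y) <= eta * Rabs (y - x)) ->
  Rabs (RInt (fun y => r y * (phi2 (x - y) - (phi1 (x + h - y) - phi1 (x - y)) / h)) u v)
  <= 4 * C * eta + 8 * C * Rabs h * M * (v - u) / delta ^ 3.
Proof.
  intros HK HC Hh Huv Hside HL Hr HC0 Heta Hdelta HM Hsmall.
  assert (Hh' := Rabs_pos_lt h Hh).
  assert (Hfar : forall y, u <= y <= v -> 2 * Rabs h <= Rabs (x - y)).
  { intros y Hy. destruct Hside; [rewrite (Rabs_left (x - y))|rewrite (Rabs_pos_eq (x - y))]; lra. }
  assert (Hx : forall y, u <= y <= v -> y <> x).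
  { intros y Hy ->. specialize (Hfar x Hy). rewrite Rminus_diag, Rabs_R0 in Hfar. lra. }
  assert (Hx' : forall y, u <= y <= v -> y <> x + h).
  { intros y Hy ->. specialize (Hfar _ Hy). replace (x - (x + h)) with (- h) in Hfar by ring.
    rewrite Rabs_Ropp in Hfar. lra. }
  assert (HMp : 0 <= M) by (eapply Rle_trans; [apply Rabs_pos|apply (HM u); lra]).
  assert (Hd3 : 0 < delta ^ 3) by now apply pow_lt.
  set (F := fun y => r y * (phi2 (x - y) - (phi1 (x + h - y) - phi1 (x - y)) / h)).
  (* A majorant of the integrand: within [delta] of [x] the bound [|r y| <= eta |y - x|] gives the
     first summand, beyond it the bound [M] gives the second. The first one integrates to at most
     [eta / (2 |h|)], which cancels the prefactor [|h|]. *)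
  set (w := fun y => 8 * C * Rabs h * (eta * / (y - x) ^ 2 + M / delta ^ 3)).
  assert (HcF : ex_RInt F u v).
  { apply (ex_RInt_continuous (V := R_CompleteNormedModule)). rewrite Rmin_left, Rmax_right by lra.
    intros y Hy. apply (continuous_mult r); [apply Hr|].
    apply (continuous_minus (fun y => phi2 (x - y)) (fun y => (phi1 (x + h - y) - phi1 (x - y)) / h)).
    - apply (continuous_kernel2 c phi phi1 phi2 phi3); auto.
    - apply (continuous_mult (fun y => phi1 (x + h - y) - phi1 (x - y)) (fun _ => / h)); [|apply continuous_const].
      apply (continuous_minus (fun y => phi1 (x + h - y)) (fun y => phi1 (x - y)));
        apply (continuous_kernel1 c phi phi1 phi2 phi3); auto. }
  assert (Hw : is_RInt w u v (8 * C * Rabs h * (eta * (/ (u - x) - / (v - x)) + (v - u) * (M / delta ^ 3)))).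
  { apply (is_RInt_scal (V := R_NormedModule) (fun y => eta * / (y - x) ^ 2 + M / delta ^ 3)).
    apply (is_RInt_plus (V := R_NormedModule) (fun y => eta * / (y - x) ^ 2) (fun _ => M / delta ^ 3)).
    - apply (is_RInt_scal (V := R_NormedModule) (fun y => / (y - x) ^ 2)). now apply is_RInt_inv_sqr.
    - apply (is_RInt_const (V := R_NormedModule)). }
  pose proof (fun lf lg => norm_RInt_le (V := R_NormedModule) F w u v lf lg Huv) as Hle.
  eapply Rle_trans; [apply Hle; [|apply (RInt_correct (V := R_CompleteNormedModule)), HcF|exact Hw]|].
  - intros y Hy. change (Rabs (F y) <= w y). unfold F, w. rewrite Rabs_mult.
    pose proof (Hfar y Hy) as Hy1. pose proof (HL y Hy) as Hy2.
    pose proof (log_kernel_taylor c L C (x - y) h phi phi1 phi2 phi3 HK HC Hh Hy1 Hy2) as HT.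
    replace (x - y + h) with (x + h - y) in HT by ring.
    eapply Rle_trans; [apply Rmult_le_compat_l; [apply Rabs_pos|exact HT]|].
    rewrite (Rabs_minus_sym x y) in *. set (t := Rabs (y - x)) in *.
    assert (Ht : 0 < t) by lra.
    replace ((y - x) ^ 2) with (t ^ 2) by apply pow2_abs.
    assert (Hq : Rabs (r y) / t ^ 3 <= eta * / t ^ 2 + M / delta ^ 3).
    { assert (0 < t ^ 3) by now apply pow_lt.
      destruct (Rle_lt_dec t delta) as [Htd|Htd].
      - apply Rle_trans with (eta * t / t ^ 3).
        + apply Rmult_le_compat_r; [left; now apply Rinv_0_lt_compat|]. now apply Hsmall.
        + assert (0 <= M / delta ^ 3) by (apply Rdiv_le_0_compat; lra).
          replace (eta * t / t ^ 3) with (eta * / t ^ 2) by (field; lra). lra.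
      - assert (0 <= eta * / t ^ 2).
        { apply Rmult_le_pos; [lra|]. left. apply Rinv_0_lt_compat, pow_lt; lra. }
        assert (Rabs (r y) / t ^ 3 <= M / delta ^ 3); [|lra].
        apply Rmult_le_compat; [apply Rabs_pos|left; now apply Rinv_0_lt_compat|now apply HM|].
        apply Rinv_le_contravar; [exact Hd3|]. apply pow_incr. lra. }
    replace (Rabs (r y) * (8 * C * Rabs h / t ^ 3)) with (8 * C * Rabs h * (Rabs (r y) / t ^ 3)).
    2: { field. lra. }
    apply Rmult_le_compat_l; [|exact Hq]. apply Rmult_le_pos; lra.
  - assert (Hi := RInt_inv_sqr_bound x u v (2 * Rabs h) ltac:(lra) Huv Hside).
    replace (4 * C * eta + 8 * C * Rabs h * M * (v - u) / delta ^ 3) with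
      (8 * C * Rabs h * (eta * / (2 * Rabs h) + (v - u) * (M / delta ^ 3))) by (field; lra).
    apply Rmult_le_compat_l; [apply Rmult_le_pos; lra|].
    apply Rplus_le_compat_r. now apply Rmult_le_compat_l.
Qed.

(** * Estimates for the remainder *)

Lemma RInt_split3 (f : R -> R) (a u v b : R) : (forall y, continuous f y) ->
  RInt f a b = RInt f a u + RInt f u v + RInt f v b.
Proof.
  intros Hf.
  rewrite <- (RInt_Chasles (V := R_CompleteNormedModule) f a u b) by now apply ex_RInt_continuous_everywhere.
  rewrite <- (RInt_Chasles (V := R_CompleteNormedModule) f u v b) by now apply ex_RInt_continuous_everywhere.
  unfold plus; simpl. ring.
Qed.

Lemma ex_RInt_continuous_le (f : R -> R) (u v : R) : u <= v ->
  (forall y, u <= y <= v -> continuous f y) -> ex_RInt f u v.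
Proof.
  intros Huv H. apply (ex_RInt_continuous (V := R_CompleteNormedModule)).
  now rewrite Rmin_left, Rmax_right by lra.
Qed.

Lemma RInt_split_le (f : R -> R) (u v w : R) : u <= v <= w ->
  (forall y, u <= y <= w -> continuous f y) -> RInt f u w = RInt f u v + RInt f v w.
Proof.
  intros H Hf. symmetry. apply (RInt_Chasles (V := R_CompleteNormedModule) f u v w);
    apply ex_RInt_continuous_le; try lra; intros; apply Hf; lra.
Qed.

(** The quotient centred at [x + h] subtracts [r (x + h)], while the one centred at [x] subtracts
    [r x = 0]. This mismatch is the last term, where the integral of [phi1] is explicit. *)
Lemma outer_decomposition (c h x u v : R) (phi phi1 phi2 phi3 r : R -> R) (q0 q1 : R) (D : R -> R) :
  log_kernel c phi phi1 phi2 phi3 -> h <> 0 -> u <= v -> r x = 0 ->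
  (forall y, u <= y <= v -> y <> x /\ y <> x + h) ->
  (forall y, continuous r y) -> (forall y, continuous D y) ->
  (forall y, D y = log_quotient c phi1 r q1 (x + h) y - log_quotient c phi1 r q0 x y) ->
  RInt (fun y => r y * phi2 (x - y)) u v - RInt D u v / h
  = RInt (fun y => r y * (phi2 (x - y) - (phi1 (x + h - y) - phi1 (x - y)) / h)) u v
    + r (x + h) / h * (phi (x + h - u) - phi (x + h - v)).
Proof.
  intros HK Hh Huv Hrx Hne Hr HDc HD.
  rewrite <- (RInt_kernel1 c phi phi1 phi2 phi3 (x + h) u v HK Huv) by (intros y Hy; apply Hne, Hy).
  set (k := r (x + h) / h).
  assert (H1 : ex_RInt (fun y => r y * phi2 (x - y)) u v).
  { apply ex_RInt_continuous_le; [exact Huv|]. intros y Hy. apply (continuous_mult r); [apply Hr|].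
    apply (continuous_kernel2 c phi phi1 phi2 phi3); [exact HK|apply Hne, Hy]. }
  assert (H2 : ex_RInt D u v) by now apply ex_RInt_continuous_everywhere.
  assert (H3 : ex_RInt (fun y => phi1 (x + h - y)) u v).
  { apply ex_RInt_continuous_le; [exact Huv|]. intros y Hy.
    apply (continuous_kernel1 c phi phi1 phi2 phi3); [exact HK|apply Hne, Hy]. }
  rewrite (RInt_ext (fun y => r y * (phi2 (x - y) - (phi1 (x + h - y) - phi1 (x - y)) / h))
    (fun y => r y * phi2 (x - y) - (/ h * D y + k * phi1 (x + h - y)))).
  2: { intros y Hy. rewrite Rmin_left, Rmax_right in Hy by lra. rewrite HD.
       destruct (Hne y ltac:(lra)) as [Hy0 Hy1]. unfold log_quotient.
       destruct (Req_EM_T y (x + h)); [easy|]. destruct (Req_EM_T y x); [easy|].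
       rewrite Hrx. unfold k. simpl. field. exact Hh. }
  rewrite (is_RInt_unique (V := R_CompleteNormedModule)
    (fun y => r y * phi2 (x - y) - (/ h * D y + k * phi1 (x + h - y))) u v
    (RInt (fun y => r y * phi2 (x - y)) u v - (/ h * RInt D u v + k * RInt (fun y => phi1 (x + h - y)) u v))).
  - unfold Rdiv. ring.
  - apply (is_RInt_minus (V := R_NormedModule) (fun y => r y * phi2 (x - y)) (fun y => / h * D y + k * phi1 (x + h - y))).
    + apply (RInt_correct (V := R_CompleteNormedModule)), H1.
    + apply (is_RInt_plus (V := R_NormedModule) (fun y => / h * D y) (fun y => k * phi1 (x + h - y))).
      * apply (is_RInt_scal (V := R_NormedModule)), (RInt_correct (V := R_CompleteNormedModule)), H2.
      * apply (is_RInt_scal (V := R_NormedModule)), (RInt_correct (V := R_CompleteNormedModule)), H3.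
Qed.

Lemma Lipschitz_near (r r' : R -> R) (a x b delta eta : R) :
  delta < x - a -> delta < b - x ->
  (forall y, a < y < b -> is_derive r y (r' y)) ->
  (forall y, Rabs (y - x) <= delta -> Rabs (r' y) <= eta) ->
  forall y z, Rabs (y - x) <= delta -> Rabs (z - x) <= delta ->
  Rabs (r y - r z) <= eta * Rabs (y - z).
Proof.
  intros Ha Hb Hr Heta y z Hy Hz.
  assert (Hin : forall w, Rmin z y <= w <= Rmax z y -> Rabs (w - x) <= delta).
  { intros w Hw. apply Rabs_le_between in Hy, Hz. apply Rabs_le.
    unfold Rmin, Rmax in Hw. destruct (Rle_dec z y); lra. }
  destruct (mean_value r r' z y) as [w [Hw E]].
  { intros w Hw. apply Hr. specialize (Hin w Hw). apply Rabs_le_between in Hin. lra. }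
  rewrite E, Rabs_mult. apply Rmult_le_compat_r; [apply Rabs_pos|]. apply Heta, Hin, Hw.
Qed.

(** Off the diagonal, a slope of size [eta] multiplies [t phi1 t], bounded by [C]; the hypothesis on
    [c] covers the diagonal value. *)
Lemma log_quotient_bound (c C L eta : R) (phi1 r : R -> R) (qs s y : R) :
  (forall t, t <> 0 -> Rabs t <= L -> Rabs (t * phi1 t) <= C) -> Rabs c <= C -> 0 <= eta ->
  Rabs (s - y) <= L -> Rabs qs <= eta -> Rabs (r y - r s) <= eta * Rabs (y - s) ->
  Rabs (log_quotient c phi1 r qs s y) <= eta * C.
Proof.
  intros HC Hc Heta HL Hq Hr. unfold log_quotient. destruct (Req_EM_T y s) as [->|Hys].
  - rewrite Rabs_Ropp, Rabs_mult, Rmult_comm. apply Rmult_le_compat; auto using Rabs_pos.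
  - specialize (HC (s - y) ltac:(lra) HL). rewrite Rabs_mult in HC. rewrite Rabs_mult.
    rewrite (Rabs_minus_sym y s) in Hr.
    apply Rle_trans with (eta * Rabs (s - y) * Rabs (phi1 (s - y))).
    + apply Rmult_le_compat_r; [apply Rabs_pos|exact Hr].
    + rewrite Rmult_assoc. now apply Rmult_le_compat_l.
Qed.

(** A logarithm varies by a bounded amount under dilation, although both values are unbounded as [e]
    tends to 0. The distances [|h|] and [3 |h|] are those of [x + h] to the two cuts at [x - 2 |h|]
    and [x + 2 |h|]. *)
Lemma log_kernel_dilation (c C L : R) (phi phi1 phi2 phi3 : R -> R) (e : R) :
  log_kernel c phi phi1 phi2 phi3 ->
  (forall t, t <> 0 -> Rabs t <= L -> Rabs (t * phi1 t) <= C) -> 0 < e -> 3 * e <= L -> 0 <= C ->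
  Rabs (phi (3 * e) - phi e) <= 2 * C.
Proof.
  intros HK HC He HL HC0. destruct (mean_value phi phi1 e (3 * e)) as [z [Hz E]].
  - rewrite Rmin_left, Rmax_right by lra. intros y Hy. apply (lk_derive0 _ _ _ _ _ HK). lra.
  - rewrite Rmin_left, Rmax_right in Hz by lra. rewrite E.
    assert (Hz0 : z <> 0) by lra. specialize (HC z Hz0). rewrite (Rabs_pos_eq z) in HC by lra.
    specialize (HC ltac:(lra)). rewrite Rabs_mult, (Rabs_pos_eq z) in HC by lra.
    rewrite Rabs_mult, (Rabs_pos_eq (3 * e - e)) by lra. pose proof (Rabs_pos (phi1 z)). nra.
Qed.

(** Cutting at distance [2 |h|] keeps [x + h] off the outer region and meets the hypothesis of
    [log_kernel_taylor]. The 20 is made of 4 for each outer integral, 1 for each annulus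
    [|h| <= |y - x| <= 2 |h|], 8 for the inner part of [D] and 2 for the dilation of [phi]; the
    terms at [a] and [b] give [2 * B]. *)
Lemma remainder_bound (c C L eta M B delta h a x b : R) (phi phi1 phi2 phi3 r r' : R -> R) :
  log_kernel c phi phi1 phi2 phi3 ->
  (forall t, t <> 0 -> Rabs t <= L ->
    Rabs (t * phi1 t) <= C /\ Rabs (t ^ 2 * phi2 t) <= C /\ Rabs (t ^ 3 * phi3 t) <= C) ->
  0 <= C -> Rabs c <= C -> 2 * (b - a) <= L ->
  (forall y, continuous r y) -> (forall y, a < y < b -> is_derive r y (r' y)) -> r x = 0 ->
  0 < delta -> delta < x - a -> delta < b - x ->
  (forall y, Rabs (y - x) <= delta -> Rabs (r' y) <= eta) ->
  (forall y, a <= y <= b -> Rabs (r y) <= M) ->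
  h <> 0 -> 2 * Rabs h <= delta ->
  Rabs (phi (x + h - a)) <= B -> Rabs (phi (x + h - b)) <= B ->
  Rabs (RInt (fun y => r y * phi2 (x - y)) a (x - Rabs h)
        + RInt (fun y => r y * phi2 (x - y)) (x + Rabs h) b
        - (RInt (log_quotient c phi1 r (r' (x + h)) (x + h)) a b
           - RInt (log_quotient c phi1 r (r' x) x) a b) / h)
  <= eta * (20 * C + 2 * B) + 16 * C * Rabs h * M * (b - a) / delta ^ 3.
Proof.
  intros HK HC HC0 Hc HL Hr Hr' Hrx Hd Hda Hdb Heta HM Hh Hhd HBa HBb.
  assert (Hh' := Rabs_pos_lt h Hh). set (e := Rabs h) in *.
  assert (Heta0 : 0 <= eta).
  { eapply Rle_trans; [apply Rabs_pos|apply (Heta x)]. rewrite Rminus_diag, Rabs_R0. lra. }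
  assert (Hlip := Lipschitz_near r r' a x b delta eta Hda Hdb Hr' Heta).
  assert (Hhb : - e <= h <= e).
  { unfold e. pose proof (Rle_abs h). pose proof (Rle_abs (- h)). rewrite Rabs_Ropp in *. lra. }
  assert (Hxx : Rabs (x - x) <= delta) by (rewrite Rminus_diag, Rabs_R0; lra).
  assert (Hxh : Rabs (x + h - x) <= delta) by (apply Rabs_le; lra).
  assert (Hsmall : forall y, Rabs (y - x) <= delta -> Rabs (r y) <= eta * Rabs (y - x)).
  { intros y Hy. specialize (Hlip y x Hy Hxx). now rewrite Hrx, Rminus_0_r in Hlip. }
  set (E1 := log_quotient c phi1 r (r' (x + h)) (x + h)).
  set (E0 := log_quotient c phi1 r (r' x) x).
  set (D := fun y => E1 y - E0 y).
  assert (HcE1 : forall y, continuous E1 y).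
  { intros y. apply (continuous_log_quotient c phi phi1 phi2 phi3); auto. apply Hr'. lra. }
  assert (HcE0 : forall y, continuous E0 y).
  { intros y. apply (continuous_log_quotient c phi phi1 phi2 phi3); auto. apply Hr'. lra. }
  assert (HcD : forall y, continuous D y).
  { intros y. apply (continuous_minus E1 E0); auto. }
  assert (HD : RInt E1 a b - RInt E0 a b = RInt D a b).
  { symmetry. apply (RInt_minus (V := R_CompleteNormedModule) E1 E0); now apply ex_RInt_continuous_everywhere. }
  rewrite HD, (RInt_split3 D a (x - 2 * e) (x + 2 * e) b HcD).
  set (G := fun y => r y * phi2 (x - y)).
  assert (HcG : forall y, y <> x -> continuous G y).
  { intros y Hy. apply (continuous_mult r); [apply Hr|]. now apply (continuous_kernel2 c phi phi1 phi2 phi3). }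
  rewrite (RInt_split_le G a (x - 2 * e) (x - e)) by (try lra; intros y Hy; apply HcG; lra).
  rewrite (RInt_split_le G (x + e) (x + 2 * e) b) by (try lra; intros y Hy; apply HcG; lra).
  assert (HL1 : forall y, a <= y <= b -> Rabs (x - y) + e <= L).
  { intros y Hy. assert (Rabs (x - y) <= b - a) by (apply Rabs_le; lra). lra. }
  assert (HC3 : forall t, t <> 0 -> Rabs t <= L -> Rabs (t ^ 3 * phi3 t) <= C) by (intros; now apply HC).
  assert (HC1 : forall t, t <> 0 -> Rabs t <= L -> Rabs (t * phi1 t) <= C) by (intros; now apply HC).
  assert (O1 := outer_decomposition c h x a (x - 2 * e) phi phi1 phi2 phi3 r (r' x) (r' (x + h)) D
    HK Hh ltac:(lra) Hrx ltac:(intros; split; lra) Hr HcD ltac:(reflexivity)).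
  assert (O2 := outer_decomposition c h x (x + 2 * e) b phi phi1 phi2 phi3 r (r' x) (r' (x + h)) D
    HK Hh ltac:(lra) Hrx ltac:(intros; split; lra) Hr HcD ltac:(reflexivity)).
  fold G in O1, O2.
  assert (P1 := outer_estimate c L C eta M delta h x a (x - 2 * e) phi phi1 phi2 phi3 r
    HK HC3 Hh ltac:(lra) ltac:(right; unfold e; lra) ltac:(intros; apply HL1; lra) Hr HC0 Heta0 Hd
    ltac:(intros; apply HM; lra) Hsmall).
  assert (P2 := outer_estimate c L C eta M delta h x (x + 2 * e) b phi phi1 phi2 phi3 r
    HK HC3 Hh ltac:(lra) ltac:(left; unfold e; lra) ltac:(intros; apply HL1; lra) Hr HC0 Heta0 Hd
    ltac:(intros; apply HM; lra) Hsmall).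
  set (F1 := RInt _ a (x - 2 * e)) in P1. fold F1 in O1.
  set (F2 := RInt _ (x + 2 * e) b) in P2. fold F2 in O2.
  assert (HDin : Rabs (RInt D (x - 2 * e) (x + 2 * e)) <= (x + 2 * e - (x - 2 * e)) * (2 * (eta * C))).
  { apply RInt_abs_bound; [lra|auto|]. intros y Hy.
    assert (Hy' : Rabs (y - x) <= delta) by (apply Rabs_le; lra).
    assert (Rabs (E1 y) <= eta * C).
    { apply log_quotient_bound with L; auto. apply Rabs_le. lra. }
    assert (Rabs (E0 y) <= eta * C).
    { apply log_quotient_bound with L; auto. apply Rabs_le. lra. }
    unfold D. eapply Rle_trans; [apply Rabs_triang|]. rewrite Rabs_Ropp. lra. }
  (* On the annulus [|r| <= eta t] and [t^2 |phi2| <= C] give [eta C / t <= eta C / e]; each half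
     has length [e], so it contributes at most [eta C]. *)
  assert (HGin : forall y, e <= Rabs (x - y) <= 2 * e -> Rabs (G y) <= eta * C / e).
  { intros y Hy. unfold G. rewrite Rabs_mult.
    assert (Hy0 : x - y <> 0) by (intros E; rewrite E, Rabs_R0 in Hy; lra).
    destruct (HC (x - y) Hy0 ltac:(lra)) as [_ [H2 _]].
    rewrite Rabs_mult, <- RPow_abs in H2.
    specialize (Hsmall y ltac:(rewrite Rabs_minus_sym; lra)). rewrite Rabs_minus_sym in Hsmall.
    set (t := Rabs (x - y)) in *. pose proof (Rabs_pos (phi2 (x - y))).
    apply Rle_trans with (eta * t * Rabs (phi2 (x - y))); [now apply Rmult_le_compat_r|].
    apply Rmult_le_reg_r with e; [exact Hh'|].
    replace (eta * C / e * e) with (eta * C) by (field; lra).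
    rewrite !Rmult_assoc. apply Rmult_le_compat_l; [exact Heta0|].
    eapply Rle_trans; [|exact H2]. replace (t ^ 2 * Rabs (phi2 (x - y))) with (t * (Rabs (phi2 (x - y)) * t)) by ring.
    apply Rmult_le_compat_l; [lra|]. apply Rmult_le_compat_l; lra. }
  assert (HG1 : Rabs (RInt G (x - 2 * e) (x - e)) <= (x - e - (x - 2 * e)) * (eta * C / e)).
  { apply RInt_abs_bound; [lra|intros y Hy; apply HcG; lra|]. intros y Hy. apply HGin.
    rewrite Rabs_pos_eq; lra. }
  assert (HG2 : Rabs (RInt G (x + e) (x + 2 * e)) <= (x + 2 * e - (x + e)) * (eta * C / e)).
  { apply RInt_abs_bound; [lra|intros y Hy; apply HcG; lra|]. intros y Hy. apply HGin.
    rewrite Rabs_left; lra. }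
  replace ((x - e - (x - 2 * e)) * (eta * C / e)) with (eta * C) in HG1 by (field; lra).
  replace ((x + 2 * e - (x + e)) * (eta * C / e)) with (eta * C) in HG2 by (field; lra).
  assert (Hk : Rabs (r (x + h) / h) <= eta).
  { unfold Rdiv. rewrite Rabs_mult, Rabs_inv. fold e. specialize (Hsmall (x + h) Hxh).
    replace (x + h - x) with h in Hsmall by ring. fold e in Hsmall.
    apply Rmult_le_reg_r with e; [exact Hh'|]. rewrite Rmult_assoc, Rinv_l by lra. lra. }
  assert (Hdil : Rabs (phi (h + 2 * e) - phi (h - 2 * e)) <= 2 * C).
  { assert (He3 := log_kernel_dilation c C L phi phi1 phi2 phi3 e HK HC1 Hh' ltac:(lra) HC0).
    destruct (Rdichotomy h 0 Hh) as [Hneg|Hpos].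
    - replace h with (- e) by (unfold e; rewrite Rabs_left by auto; ring).
      replace (- e + 2 * e) with e by ring. replace (- e - 2 * e) with (- (3 * e)) by ring.
      rewrite (lk_even0 _ _ _ _ _ HK), Rabs_minus_sym. exact He3.
    - replace h with e by (unfold e; rewrite Rabs_pos_eq by lra; ring).
      replace (e + 2 * e) with (3 * e) by ring. replace (e - 2 * e) with (- e) by ring.
      rewrite (lk_even0 _ _ _ _ _ HK). exact He3. }
  assert (HDh : Rabs (RInt D (x - 2 * e) (x + 2 * e) / h) <= 8 * (eta * C)).
  { unfold Rdiv. rewrite Rabs_mult, Rabs_inv. fold e. apply Rmult_le_reg_r with e; [exact Hh'|].
    rewrite Rmult_assoc, Rinv_l by lra. lra. }
  replace (x + h - (x - 2 * e)) with (h + 2 * e) in O1 by ring.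
  replace (x + h - (x + 2 * e)) with (h - 2 * e) in O2 by ring.
  set (k := r (x + h) / h) in *.
  replace (RInt G a (x - 2 * e) + RInt G (x - 2 * e) (x - e) + (RInt G (x + e) (x + 2 * e) + RInt G (x + 2 * e) b)
    - (RInt D a (x - 2 * e) + RInt D (x - 2 * e) (x + 2 * e) + RInt D (x + 2 * e) b) / h)
  with (F1 + F2 + RInt G (x - 2 * e) (x - e) + RInt G (x + e) (x + 2 * e) - RInt D (x - 2 * e) (x + 2 * e) / h
    + k * ((phi (x + h - a) - phi (x + h - b)) - (phi (h + 2 * e) - phi (h - 2 * e)))).
  2: { transitivity ((F1 + k * (phi (x + h - a) - phi (h + 2 * e))) + (F2 + k * (phi (h - 2 * e) - phi (x + h - b)))
        + RInt G (x - 2 * e) (x - e) + RInt G (x + e) (x + 2 * e) - RInt D (x - 2 * e) (x + 2 * e) / h); [ring|].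
       rewrite <- O1, <- O2. unfold Rdiv. ring. }
  assert (Hkk : Rabs (k * ((phi (x + h - a) - phi (x + h - b)) - (phi (h + 2 * e) - phi (h - 2 * e)))) <= eta * (2 * B + 2 * C)).
  { rewrite Rabs_mult. apply Rmult_le_compat; auto using Rabs_pos.
    eapply Rle_trans; [apply Rabs_triang|]. rewrite Rabs_Ropp. apply Rplus_le_compat; [|exact Hdil].
    eapply Rle_trans; [apply Rabs_triang|]. rewrite Rabs_Ropp. lra. }
  assert (HMp : 0 <= M) by (eapply Rle_trans; [apply Rabs_pos|apply (HM x); lra]).
  assert (Hd3 : 0 < delta ^ 3) by now apply pow_lt.
  assert (Hfar : 8 * C * e * M * (x - 2 * e - a) / delta ^ 3 + 8 * C * e * M * (b - (x + 2 * e)) / delta ^ 3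
    <= 16 * C * e * M * (b - a) / delta ^ 3).
  { assert (0 <= C * e * M) by (apply Rmult_le_pos; [apply Rmult_le_pos|]; lra).
    assert (0 < / delta ^ 3) by now apply Rinv_0_lt_compat.
    unfold Rdiv. rewrite <- Rmult_plus_distr_r. apply Rmult_le_compat_r; [lra|]. nra. }
  fold e in P1, P2.
  apply Rabs_le_between in P1, P2, HG1, HG2, HDh, Hkk.
  apply Rabs_le. lra.
Qed.

(** * The finite part and the single layer potential *)

Lemma locally'_0_lt (d : R) : 0 < d -> locally' 0 (fun h => h <> 0 /\ Rabs h < d).
Proof.
  intros Hd. exists (mkposreal d Hd). intros h Hh Hh0. split; [exact Hh0|].
  change (Rabs (h - 0) < d) in Hh. now rewrite Rminus_0_r in Hh.
Qed.

Lemma at_right_0_lt (d : R) : 0 < d -> at_right 0 (fun h => 0 < h < d).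
Proof.
  intros Hd. exists (mkposreal d Hd). intros h Hh Hh0. split; [exact Hh0|].
  change (Rabs (h - 0) < d) in Hh. rewrite Rminus_0_r in Hh. apply Rabs_def2 in Hh. lra.
Qed.

Lemma filterlim_Rabs_bound {T} (F : (T -> Prop) -> Prop) {FF : Filter F} (f : T -> R) :
  (forall eps, 0 < eps -> F (fun h => Rabs (f h) < eps)) -> filterlim f F (locally 0).
Proof.
  intros H. apply filterlim_locally. intros eps. eapply filter_imp; [|exact (H eps (cond_pos eps))].
  intros h Hh. change (Rabs (f h - 0) < eps). now rewrite Rminus_0_r.
Qed.

Lemma continuous_bounded_near (f : R -> R) (x : R) : continuous f x ->
  locally' 0 (fun h => Rabs (f (x + h)) <= Rabs (f x) + 1).
Proof.
  intros H. apply filterlim_locally with (eps := mkposreal 1 Rlt_0_1) in H.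
  destruct H as [d Hd]. exists d. intros h Hh _. change (Rabs (h - 0) < d) in Hh.
  rewrite Rminus_0_r in Hh. specialize (Hd (x + h)).
  assert (Ey : x + h - x = h) by ring.
  assert (Hb : ball x d (x + h)) by (change (Rabs (x + h - x) < d); now rewrite Ey).
  specialize (Hd Hb). change (Rabs (f (x + h) - f x) < 1) in Hd.
  pose proof (Rabs_triang (f (x + h) - f x) (f x)) as Ht.
  assert (Ef : f (x + h) - f x + f x = f (x + h)) by ring. rewrite Ef in Ht. lra.
Qed.

Lemma small_near (r' : R -> R) (a x b eta : R) : a < x < b -> continuous r' x -> r' x = 0 -> 0 < eta ->
  exists delta, 0 < delta /\ delta < x - a /\ delta < b - x /\
    forall y, Rabs (y - x) <= delta -> Rabs (r' y) <= eta.
Proof.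
  intros Hx Hc H0 Heta. apply filterlim_locally with (eps := mkposreal eta Heta) in Hc.
  destruct Hc as [d Hd]. pose proof (cond_pos d) as Hd0.
  set (m := Rmin d (Rmin (x - a) (b - x))).
  assert (H1 := Rmin_l d (Rmin (x - a) (b - x))). assert (H2 := Rmin_r d (Rmin (x - a) (b - x))).
  assert (H3 := Rmin_l (x - a) (b - x)). assert (H4 := Rmin_r (x - a) (b - x)). fold m in H1, H2.
  assert (Hm : 0 < m) by (unfold m; repeat apply Rmin_case; lra).
  exists (m / 2). repeat split; try lra.
  intros y Hy. specialize (Hd y). assert (Hb : ball x d y) by (change (Rabs (y - x) < d); lra).
  specialize (Hd Hb). change (Rabs (r' y - r' x) < eta) in Hd. rewrite H0, Rminus_0_r in Hd. lra.
Qed.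

Definition truncated_RInt (F : R -> R) (a x b eps : R) : R :=
  RInt F a (x - eps) + RInt F (x + eps) b.

Lemma remainder_limit (c a x b : R) (phi phi1 phi2 phi3 r r' : R -> R) :
  log_kernel c phi phi1 phi2 phi3 -> a < x < b ->
  (forall y, continuous r y) -> (forall y, a < y < b -> is_derive r y (r' y)) ->
  r x = 0 -> r' x = 0 -> continuous r' x ->
  filterlim (fun h => truncated_RInt (fun y => r y * phi2 (x - y)) a x b (Rabs h)
        - (RInt (log_quotient c phi1 r (r' (x + h)) (x + h)) a b
           - RInt (log_quotient c phi1 r (r' x) x) a b) / h) (locally' 0) (locally 0).
Proof.
  intros HK Hx Hr Hr' Hrx Hr'x Hc. apply (filterlim_Rabs_bound (locally' 0)). intros eps Heps.
  destruct (lk_bound _ _ _ _ _ HK (2 * (b - a))) as [C0 [HC0 HC]].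
  set (C := Rmax C0 (Rabs c)).
  assert (HC0C : C0 <= C) by apply Rmax_l. assert (HcC : Rabs c <= C) by apply Rmax_r.
  destruct (bounded_continuity (V := R_NormedModule) r a b) as [M HM]; [intros; apply Hr|].
  assert (HMp : 0 <= M).
  { specialize (HM x ltac:(lra)). change (Rabs (r x) < M) in HM. pose proof (Rabs_pos (r x)). lra. }
  set (B := Rabs (phi (x - a)) + Rabs (phi (x - b)) + 1).
  assert (HpA := Rabs_pos (phi (x - a))). assert (HpB := Rabs_pos (phi (x - b))).
  (* Order of choice: [eta] makes the first term of [remainder_bound] at most [eps / 2]; [delta]
     follows from [eta]; the size of [h] depends on [delta] and makes the far term less than
     [eps / 2]. The added 1, here and in [m + 1], keeps the denominators positive. *)
  set (eta := eps / (2 * (20 * C + 2 * B + 1))).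
  assert (HB : 0 <= B) by (unfold B; lra).
  assert (Heta : 0 < eta) by (apply Rdiv_lt_0_compat; lra).
  destruct (small_near r' a x b eta Hx Hc Hr'x Heta) as (delta & Hd & Hda & Hdb & Hsm).
  assert (Hd3 : 0 < delta ^ 3) by now apply pow_lt.
  set (m := 16 * C * M * (b - a)).
  assert (Hm : 0 <= m) by (unfold m; repeat apply Rmult_le_pos; lra).
  assert (F1 := locally'_0_lt (delta / 2) ltac:(lra)).
  assert (F2 := locally'_0_lt (eps * delta ^ 3 / (2 * (m + 1))) ltac:(apply Rdiv_lt_0_compat; nra)).
  assert (F3 := continuous_bounded_near phi (x - a) (is_derive_continuous _ _ _ (lk_derive0 _ _ _ _ _ HK (x - a) ltac:(lra)))).
  assert (F4 := continuous_bounded_near phi (x - b) (is_derive_continuous _ _ _ (lk_derive0 _ _ _ _ _ HK (x - b) ltac:(lra)))).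
  generalize (filter_and _ _ (filter_and _ _ F1 F2) (filter_and _ _ F3 F4)). apply filter_imp.
  intros h [[[Hh H1] [_ H2]] [H3 H4]].
  replace (x - a + h) with (x + h - a) in H3 by ring. replace (x - b + h) with (x + h - b) in H4 by ring.
  eapply Rle_lt_trans; [apply (remainder_bound c C (2 * (b - a)) eta M B delta h a x b phi phi1 phi2 phi3 r r')|];
    auto; try lra; try (unfold B; lra).
  - intros t Ht HtL. destruct (HC t Ht HtL) as (? & ? & ?). lra.
  - intros y Hy. specialize (HM y Hy). change (Rabs (r y) < M) in HM. lra.
  - assert (E1 : eta * (20 * C + 2 * B) <= eps / 2).
    { replace (eps / 2) with (eta * (20 * C + 2 * B + 1)) by (unfold eta; field; lra).
      apply Rmult_le_compat_l; lra. }
    assert (E2 : 16 * C * Rabs h * M * (b - a) / delta ^ 3 < eps / 2); [|lra].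
    apply Rmult_lt_reg_r with (delta ^ 3); [exact Hd3|].
    replace (16 * C * Rabs h * M * (b - a) / delta ^ 3 * delta ^ 3) with (m * Rabs h) by (unfold m; field; lra).
    apply Rle_lt_trans with ((m + 1) * Rabs h); [pose proof (Rabs_pos h); nra|].
    apply Rlt_le_trans with ((m + 1) * (eps * delta ^ 3 / (2 * (m + 1)))); [apply Rmult_lt_compat_l; lra|].
    apply Req_le. field. lra.
Qed.

Definition remainder (f : R -> R) (x gx y : R) : R := f y - f x - gx * (y - x).

Lemma continuous_remainder (f : R -> R) (x gx y : R) : continuous f y -> continuous (remainder f x gx) y.
Proof.
  intros H. apply (continuous_minus (fun y => f y - f x) (fun y => gx * (y - x))).
  - apply (continuous_minus f (fun _ => f x)); [exact H|apply continuous_const].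
  - eapply is_derive_continuous. auto_derive; [trivial|reflexivity].
Qed.

Lemma is_derive_remainder (f : R -> R) (x gx y d : R) :
  is_derive f y d -> is_derive (remainder f x gx) y (d - gx).
Proof.
  intros H. unfold remainder. apply is_derive_ext with (fun y => f y - (f x + gx * (y - x))); [intros; simpl; ring|].
  eapply is_derive_Rminus; [exact H| |reflexivity]. auto_derive; [trivial|ring].
Qed.

(* An antiderivative of the affine part of [f] at [x] times [phi2 (x - y)]. *)
Definition affine_primitive (phi phi1 : R -> R) (x fx gx y : R) : R :=
  - ((fx + gx * (y - x)) * phi1 (x - y)) - gx * phi (x - y).

Lemma RInt_affine_remainder (c : R) (phi phi1 phi2 phi3 f : R -> R) (x gx u v : R) :
  log_kernel c phi phi1 phi2 phi3 -> (forall y, continuous f y) ->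
  u <= v -> (forall y, u <= y <= v -> y <> x) ->
  RInt (fun y => f y * phi2 (x - y)) u v
  = RInt (fun y => remainder f x gx y * phi2 (x - y)) u v
    + (affine_primitive phi phi1 x (f x) gx v - affine_primitive phi phi1 x (f x) gx u).
Proof.
  intros HK Hf Huv Hne.
  assert (Haff : is_RInt (fun y => (f x + gx * (y - x)) * phi2 (x - y)) u v
    (affine_primitive phi phi1 x (f x) gx v - affine_primitive phi phi1 x (f x) gx u)).
  { apply is_RInt_primitive; [exact Huv| |].
    - intros y Hy. specialize (Hne y Hy). unfold affine_primitive.
      apply is_derive_ext with (fun y => -1 * ((f x + gx * (y - x)) * phi1 (x - y)) - gx * phi (x - y)); [intros; simpl; ring|].
      eapply is_derive_Rminus.
      + eapply is_derive_Rscal; [|reflexivity].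
        eapply is_derive_Rmult; [|apply is_derive_reflect, (lk_derive1 _ _ _ _ _ HK); lra|reflexivity].
        instantiate (1 := gx). auto_derive; [trivial|ring].
      + eapply is_derive_Rscal; [apply is_derive_reflect, (lk_derive0 _ _ _ _ _ HK); lra|reflexivity].
      + simpl. ring.
    - intros y Hy. apply (continuous_mult (fun y => f x + gx * (y - x)) (fun y => phi2 (x - y))).
      + eapply is_derive_continuous. auto_derive; [trivial|reflexivity].
      + apply (continuous_kernel2 c phi phi1 phi2 phi3); auto. }
  apply (is_RInt_unique (V := R_CompleteNormedModule)).
  apply (is_RInt_ext (V := R_NormedModule)) with (fun y => remainder f x gx y * phi2 (x - y) + (f x + gx * (y - x)) * phi2 (x - y)).
  { intros y _. unfold remainder. simpl. ring. }
  apply (is_RInt_plus (V := R_NormedModule)); [|exact Haff].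
  apply (RInt_correct (V := R_CompleteNormedModule)), ex_RInt_continuous_le; [exact Huv|].
  intros y Hy. apply (continuous_mult (remainder f x gx) (fun y => phi2 (x - y))).
  - apply continuous_remainder, Hf.
  - apply (continuous_kernel2 c phi phi1 phi2 phi3); auto.
Qed.

(** As [phi] is even and [phi1] odd, the contributions of the slope [gx] at [x - e] and [x + e]
    cancel. Only [- 2 f (x) phi1 e], asymptotic to [- 2 c f (x) / e], survives, without any
    logarithm. *)
Lemma truncated_RInt_affine_remainder (c : R) (phi phi1 phi2 phi3 f : R -> R) (a x b gx e : R) :
  log_kernel c phi phi1 phi2 phi3 -> (forall y, continuous f y) ->
  0 < e -> e < x - a -> e < b - x ->
  truncated_RInt (fun y => f y * phi2 (x - y)) a x b e
  = truncated_RInt (fun y => remainder f x gx y * phi2 (x - y)) a x b e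
    + (affine_primitive phi phi1 x (f x) gx b - affine_primitive phi phi1 x (f x) gx a)
    - 2 * f x * phi1 e.
Proof.
  intros HK Hf He Ha Hb. unfold truncated_RInt.
  rewrite (RInt_affine_remainder c phi phi1 phi2 phi3 f x gx a (x - e)) by (auto; try lra; intros; lra).
  rewrite (RInt_affine_remainder c phi phi1 phi2 phi3 f x gx (x + e) b) by (auto; try lra; intros; lra).
  unfold affine_primitive. replace (x - (x - e)) with e by ring. replace (x - (x + e)) with (- e) by ring.
  rewrite (lk_odd1 _ _ _ _ _ HK), (lk_even0 _ _ _ _ _ HK). ring.
Qed.

(** For the identity the quotient depends on [y - s] only, so a translation makes the dependence on
    [s] explicit and differentiable. *)
Lemma RInt_log_quotient_id (c : R) (phi phi1 phi2 phi3 : R -> R) (a b s : R) :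
  log_kernel c phi phi1 phi2 phi3 ->
  let X := RInt (log_quotient c phi1 (fun y => y) 1 0) 0 in
  is_RInt (log_quotient c phi1 (fun y => y) 1 s) a b (X (b - s) - X (a - s)).
Proof.
  intros HK X. set (e0 := log_quotient c phi1 (fun y => y) 1 0) in *.
  assert (Hc : forall y, continuous e0 y).
  { intros y. apply (continuous_log_quotient c phi phi1 phi2 phi3); [exact HK|apply continuous_id|].
    apply (is_derive_id (K := R_AbsRing)). }
  apply (is_RInt_ext (V := R_NormedModule)) with (fun y => e0 (y - s)).
  { intros y _. unfold e0, log_quotient.
    destruct (Req_EM_T (y - s) 0), (Req_EM_T y s); try lra. f_equal; [ring|f_equal; ring]. }
  apply (is_RInt_derive (V := R_CompleteNormedModule) (fun y => X (y - s))).
  - intros y _. eapply is_derive_Rcomp; [apply is_derive_RInt_continuous, Hc| |].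
    + auto_derive; [trivial|reflexivity].
    + simpl. ring.
  - intros y _. apply (continuous_comp (fun y => y - s) e0); [|apply Hc].
    eapply is_derive_continuous. auto_derive; [trivial|reflexivity].
Qed.

(* The value of the integral of [f' (y) * phi (s - y)] over [(a, b)]. *)
Definition single_layer (c : R) (phi phi1 f g : R -> R) (a b s : R) : R :=
  log_primitive c phi phi1 f (g s) s b - log_primitive c phi phi1 f (g s) s a.

(** [log_quotient] is linear in [p] and kills constants, so the affine part of [f] at [x]
    contributes [gx] times the quotient of the identity. The zeros of [f] at the edges leave only
    multiples of [f s] in the boundary terms. *)
Lemma single_layer_decomposition (c a b gx x s : R) (phi phi1 phi2 phi3 f g : R -> R) :
  log_kernel c phi phi1 phi2 phi3 -> (forall y, continuous f y) ->
  f a = 0 -> f b = 0 -> is_derive f s (g s) ->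
  let X := RInt (log_quotient c phi1 (fun y => y) 1 0) 0 in
  single_layer c phi phi1 f g a b s
  = RInt (log_quotient c phi1 (remainder f x gx) (g s - gx) s) a b
    + (f s * (phi (s - a) - phi (s - b)) + gx * (X (b - s) - X (a - s))).
Proof.
  intros HK Hf Ha Hb Hs X. unfold single_layer.
  rewrite (log_primitive_diff c phi phi1 phi2 phi3) by auto.
  rewrite Ha, Hb.
  assert (E : RInt (log_quotient c phi1 f (g s) s) a b
    = RInt (log_quotient c phi1 (remainder f x gx) (g s - gx) s) a b + gx * (X (b - s) - X (a - s))); [|rewrite E; ring].
  apply (is_RInt_unique (V := R_CompleteNormedModule)).
  apply (is_RInt_ext (V := R_NormedModule)) with (fun y => log_quotient c phi1 (remainder f x gx) (g s - gx) s y
    + gx * log_quotient c phi1 (fun y => y) 1 s y).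
  { intros y _. unfold log_quotient, remainder. destruct (Req_EM_T y s); simpl; ring. }
  apply (is_RInt_plus (V := R_NormedModule)).
  - apply (RInt_correct (V := R_CompleteNormedModule)), ex_RInt_continuous_everywhere.
    intros y. apply (continuous_log_quotient c phi phi1 phi2 phi3); [exact HK|apply continuous_remainder, Hf|].
    now apply is_derive_remainder.
  - apply (is_RInt_scal (V := R_NormedModule)). now apply (RInt_log_quotient_id c phi phi1 phi2 phi3).
Qed.

Lemma kernel1_lim_Rabs (c : R) (phi phi1 phi2 phi3 : R -> R) : log_kernel c phi phi1 phi2 phi3 ->
  filterlim (fun h => phi1 (Rabs h) - c / Rabs h) (locally' 0) (locally 0).
Proof.
  intros HK. apply (filterlim_locally'_0 (fun t => phi1 t - c / t)).
  apply filterlim_at_right_locally', (lk_lim1 _ _ _ _ _ HK).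
Qed.

Lemma finite_part_single_layer (c a x b : R) (phi phi1 phi2 phi3 f g : R -> R) :
  log_kernel c phi phi1 phi2 phi3 -> a < x < b -> (forall y, continuous f y) ->
  (forall y, a < y < b -> is_derive f y (g y)) -> continuous g x ->
  f a = 0 -> f b = 0 ->
  filterlim (fun h => truncated_RInt (fun y => f y * phi2 (x - y)) a x b (Rabs h) + 2 * c * f x / Rabs h
        - (single_layer c phi phi1 f g a b (x + h) - single_layer c phi phi1 f g a b x) / h)
    (locally' 0) (locally 0).
Proof.
  intros HK Hx Hf Hg Hgx Ha Hb.
  set (r := remainder f x (g x)). set (r' := fun y => g y - g x).
  set (X := RInt (log_quotient c phi1 (fun y => y) 1 0) 0).
  set (U := fun s => f s * (phi (s - a) - phi (s - b)) + g x * (X (b - s) - X (a - s))).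
  set (P := affine_primitive phi phi1 x (f x) (g x)).
  assert (HR := remainder_limit c a x b phi phi1 phi2 phi3 r r' HK Hx).
  (* The explicit part of the potential has as derivative exactly the explicit part of the truncated
     integral, so the two cancel in the limit and [remainder_limit] deals with the rest. *)
  assert (HU : is_derive U x (P b - P a)).
  { assert (HX : forall y, is_derive X y (log_quotient c phi1 (fun y => y) 1 0 y)).
    { intros z. apply is_derive_RInt_continuous. intros y.
      apply (continuous_log_quotient c phi phi1 phi2 phi3); [exact HK|apply continuous_id|].
      apply (is_derive_id (K := R_AbsRing)). }
    unfold U. eapply is_derive_Rplus.
    - eapply is_derive_Rmult; [apply Hg, Hx| |reflexivity].
      eapply is_derive_Rminus; [| |reflexivity].
      + eapply is_derive_Rcomp; [apply (lk_derive0 _ _ _ _ _ HK); lra| |reflexivity].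
        auto_derive; [trivial|reflexivity].
      + eapply is_derive_Rcomp; [apply (lk_derive0 _ _ _ _ _ HK); lra| |reflexivity].
        auto_derive; [trivial|reflexivity].
    - eapply is_derive_Rscal; [|reflexivity].
      eapply is_derive_Rminus; [apply is_derive_reflect, HX|apply is_derive_reflect, HX|reflexivity].
    - unfold P, affine_primitive, log_quotient.
      destruct (Req_EM_T (b - x) 0); [lra|]. destruct (Req_EM_T (a - x) 0); [lra|].
      replace (0 - (b - x)) with (x - b) by ring. replace (0 - (a - x)) with (x - a) by ring.
      simpl. ring. }
  apply is_derive_difference_quotient in HU.
  assert (HL := kernel1_lim_Rabs c phi phi1 phi2 phi3 HK).
  assert (Hr'c : continuous r' x).
  { apply (continuous_minus g (fun _ => g x)); [exact Hgx|apply continuous_const]. }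
  specialize (HR (fun y => continuous_remainder f x (g x) y (Hf y))
    (fun y Hy => is_derive_remainder f x (g x) y _ (Hg y Hy))
    ltac:(unfold r, remainder; ring) ltac:(unfold r'; ring) Hr'c).
  set (Q := fun h => truncated_RInt (fun y => r y * phi2 (x - y)) a x b (Rabs h)
        - (RInt (log_quotient c phi1 r (r' (x + h)) (x + h)) a b
           - RInt (log_quotient c phi1 r (r' x) x) a b) / h) in *.
  assert (H : filterlim (fun h => Q h + (-1 * ((U (x + h) - U x) / h) + (P b - P a)
     + -2 * f x * (phi1 (Rabs h) - c / Rabs h))) (locally' 0) (locally 0)).
  { apply (filterlim_Rplus (locally' 0) _ _ 0 0); [exact HR| |ring].
    apply (filterlim_Rplus (locally' 0) _ _ 0 0); [| |ring].
    - apply (filterlim_Rplus (locally' 0) _ _ (-1 * (P b - P a)) (P b - P a)); [|apply filterlim_const|ring].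
      apply (filterlim_Rmult (locally' 0) _ _ (-1) (P b - P a)); [apply filterlim_const|exact HU|ring].
    - apply (filterlim_Rmult (locally' 0) _ _ (-2 * f x) 0); [apply filterlim_const|exact HL|ring]. }
  assert (Hm : 0 < Rmin (x - a) (b - x)) by (apply Rmin_case; lra).
  refine (filterlim_ext_loc _ _ _ H).
  generalize (locally'_0_lt _ Hm). apply filter_imp. intros h [Hh0 Hh].
  assert (H1 := Rmin_l (x - a) (b - x)). assert (H2 := Rmin_r (x - a) (b - x)).
  assert (Hh' := Rabs_pos_lt h Hh0). assert (H3 := Hh). apply Rabs_def2 in H3.
  rewrite (truncated_RInt_affine_remainder c phi phi1 phi2 phi3 f a x b (g x)) by (auto; lra).
  rewrite (single_layer_decomposition c a b (g x) x (x + h) phi phi1 phi2 phi3) by (auto; apply Hg; lra).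
  rewrite (single_layer_decomposition c a b (g x) x x phi phi1 phi2 phi3) by (auto; apply Hg; lra).
  fold X. fold (U (x + h)) (U x). fold r. fold (r' (x + h)) (r' x). fold P. unfold Q. field. lra.
Qed.

(** Passing from [e] to [e / 2] adds two intervals of length [e / 2], on which the integrand of the
    remainder is at most [eta C / (e / 2)]. The affine part varies through [phi1 e - c / e] and the
    same at [e / 2], which both tend to 0. No difference quotient of the potential occurs, so this
    holds whether or not the finite part exists. *)
Lemma finite_part_dyadic (c a x b : R) (phi phi1 phi2 phi3 f g : R -> R) :
  log_kernel c phi phi1 phi2 phi3 -> a < x < b -> (forall y, continuous f y) ->
  (forall y, a < y < b -> is_derive f y (g y)) -> continuous g x ->
  let T := fun e => truncated_RInt (fun y => f y * phi2 (x - y)) a x b e + 2 * c * f x / e in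
  filterlim (fun e => T e - T (e / 2)) (at_right 0) (locally 0).
Proof.
  intros HK Hx Hf Hg Hgx T.
  set (r := remainder f x (g x)). set (r' := fun y => g y - g x).
  assert (Hr'c : continuous r' x).
  { apply (continuous_minus g (fun _ => g x)); [exact Hgx|apply continuous_const]. }
  assert (Hr : forall y, continuous r y) by (intros; apply continuous_remainder, Hf).
  assert (Hr' : forall y, a < y < b -> is_derive r y (r' y)) by (intros; now apply is_derive_remainder, Hg).
  set (G := fun y => r y * phi2 (x - y)).
  assert (HcG : forall y, y <> x -> continuous G y).
  { intros y Hy. apply (continuous_mult r); [apply Hr|]. now apply (continuous_kernel2 c phi phi1 phi2 phi3). }
  assert (Hm : 0 < Rmin (x - a) (b - x)) by (apply Rmin_case; lra).
  assert (H1 := Rmin_l (x - a) (b - x)). assert (H2 := Rmin_r (x - a) (b - x)).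
  assert (HG : filterlim (fun e => truncated_RInt G a x b e - truncated_RInt G a x b (e / 2)) (at_right 0) (locally 0)).
  { apply (filterlim_Rabs_bound (at_right 0)). intros eps Heps.
    destruct (lk_bound _ _ _ _ _ HK (b - a)) as [C [HC0 HC]].
    assert (Heta : 0 < eps / (2 * (C + 1))) by (apply Rdiv_lt_0_compat; lra).
    destruct (small_near r' a x b _ Hx Hr'c ltac:(unfold r'; ring) Heta) as (delta & Hd & Hda & Hdb & Hsm).
    set (eta := eps / (2 * (C + 1))) in *.
    assert (Hlip := Lipschitz_near r r' a x b delta eta Hda Hdb Hr' Hsm).
    generalize (at_right_0_lt _ Hd). apply filter_imp. intros e He.
    unfold truncated_RInt.
    rewrite (RInt_split_le G a (x - e) (x - e / 2)) by (try lra; intros y Hy; apply HcG; lra).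
    rewrite (RInt_split_le G (x + e / 2) (x + e) b) by (try lra; intros y Hy; apply HcG; lra).
    assert (HGin : forall y, e / 2 <= Rabs (x - y) <= e -> Rabs (G y) <= eta * C / (e / 2)).
    { intros y Hy. unfold G. rewrite Rabs_mult.
      assert (Hy0 : x - y <> 0) by (intros E; rewrite E, Rabs_R0 in Hy; lra).
      destruct (HC (x - y) Hy0 ltac:(lra)) as [_ [Hq _]].
      rewrite Rabs_mult, <- RPow_abs in Hq.
      specialize (Hlip y x ltac:(rewrite Rabs_minus_sym; lra) ltac:(rewrite Rminus_diag, Rabs_R0; lra)).
      replace (r x) with 0 in Hlip by (unfold r, remainder; ring). rewrite Rminus_0_r, Rabs_minus_sym in Hlip.
      set (t := Rabs (x - y)) in *. pose proof (Rabs_pos (phi2 (x - y))).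
      apply Rle_trans with (eta * t * Rabs (phi2 (x - y))); [now apply Rmult_le_compat_r|].
      apply Rmult_le_reg_r with (e / 2); [lra|].
      replace (eta * C / (e / 2) * (e / 2)) with (eta * C) by (field; lra).
      rewrite !Rmult_assoc. apply Rmult_le_compat_l; [lra|].
      eapply Rle_trans; [|exact Hq].
      replace (t ^ 2 * Rabs (phi2 (x - y))) with (t * (Rabs (phi2 (x - y)) * t)) by ring.
      apply Rmult_le_compat_l; [lra|]. apply Rmult_le_compat_l; lra. }
    assert (HG1 : Rabs (RInt G (x - e) (x - e / 2)) <= (x - e / 2 - (x - e)) * (eta * C / (e / 2))).
    { apply RInt_abs_bound; [lra|intros y Hy; apply HcG; lra|]. intros y Hy. apply HGin.
      rewrite Rabs_pos_eq; lra. }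
    assert (HG2 : Rabs (RInt G (x + e / 2) (x + e)) <= (x + e - (x + e / 2)) * (eta * C / (e / 2))).
    { apply RInt_abs_bound; [lra|intros y Hy; apply HcG; lra|]. intros y Hy. apply HGin.
      rewrite Rabs_left; lra. }
    replace ((x - e / 2 - (x - e)) * (eta * C / (e / 2))) with (eta * C) in HG1 by (field; lra).
    replace ((x + e - (x + e / 2)) * (eta * C / (e / 2))) with (eta * C) in HG2 by (field; lra).
    assert (HE : 2 * (eta * (C + 1)) = eps) by (unfold eta; field; lra).
    apply Rabs_le_between in HG1, HG2. apply Rabs_def1; lra. }
  assert (HL : filterlim (fun e => phi1 e - c / e) (at_right 0) (locally 0)).
  { apply filterlim_at_right_locally', (lk_lim1 _ _ _ _ _ HK). }
  assert (HL2 : filterlim (fun e => phi1 (e / 2) - c / (e / 2)) (at_right 0) (locally 0)).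
  { apply (filterlim_comp _ _ _ (fun e => e / 2) (fun e => phi1 e - c / e) _ (at_right 0)); [|exact HL].
    apply (filterlim_ext (fun e => / 2 * e)); [intros; field|]. apply at_right_scale. lra. }
  assert (H : filterlim (fun e => truncated_RInt G a x b e - truncated_RInt G a x b (e / 2)
    + (-2 * f x * (phi1 e - c / e) + 2 * f x * (phi1 (e / 2) - c / (e / 2)))) (at_right 0) (locally 0)).
  { apply (filterlim_Rplus (at_right 0) _ _ 0 0); [exact HG| |ring].
    apply (filterlim_Rplus (at_right 0) _ _ 0 0); [| |ring].
    - apply (filterlim_Rmult (at_right 0) _ _ (-2 * f x) 0); [apply filterlim_const|exact HL|ring].
    - apply (filterlim_Rmult (at_right 0) _ _ (2 * f x) 0); [apply filterlim_const|exact HL2|ring]. }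
  refine (filterlim_ext_loc _ _ _ H).
  generalize (at_right_0_lt _ Hm). apply filter_imp. intros e He. unfold T.
  rewrite (truncated_RInt_affine_remainder c phi phi1 phi2 phi3 f a x b (g x) e) by (auto; lra).
  rewrite (truncated_RInt_affine_remainder c phi phi1 phi2 phi3 f a x b (g x) (e / 2)) by (auto; lra).
  fold r. fold G. field. lra.
Qed.

(* One real component of the two boundary operators at [x]: [h0 s], [hG] and [h1]
   are the integrands of the single layer potential at [s] of the tangential
   derivative, of the single layer potential at [x], and of the finite part;
   [A] is the coefficient of [1 / eps] to be discarded (times [k]). *)
Record layer (k a x b : R) (h0 : R -> R -> R) (hG h1 : R -> R)
    (V1 V2 : R -> R) (G1 G2 A : R) : Prop := {
  layer_potential : forall s, a < s < b ->
    is_RInt_gen (h0 s) (at_right a) (at_left s) (V1 s) /\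
    is_RInt_gen (h0 s) (at_right s) (at_left b) (V2 s);
  layer_left : is_RInt_gen hG (at_right a) (at_left x) G1;
  layer_right : is_RInt_gen hG (at_right x) (at_left b) G2;
  layer_ex_RInt : forall e, 0 < e < Rmin (x - a) (b - x) ->
    ex_RInt h1 a (x - e) /\ ex_RInt h1 (x + e) b;
  layer_limit : filterlim
    (fun h => k * truncated_RInt h1 a x b (Rabs h) - A / Rabs h - k ^ 2 * (G1 + G2)
       - ((V1 (x + h) + V2 (x + h)) - (V1 x + V2 x)) / h) (locally' 0) (locally 0);
  layer_dyadic : filterlim
    (fun e => (k * truncated_RInt h1 a x b e - A / e)
       - (k * truncated_RInt h1 a x b (e / 2) - A / (e / 2))) (at_right 0) (locally 0)
}.

Lemma truncated_RInt_single_layer (c : R) (phi phi1 phi2 phi3 f : R -> R) (a x b : R) :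
  log_kernel c phi phi1 phi2 phi3 -> a < x < b -> (forall y, continuous f y) ->
  let N := log_primitive c phi phi1 (RInt f a) (f x) x in
  filterlim (truncated_RInt (fun y => f y * phi (x - y)) a x b) (at_right 0) (locally (- N a + N b)).
Proof.
  intros HK Hx Hf N.
  assert (Hp : forall y, is_derive (RInt f a) y (f y)) by (intros; now apply is_derive_RInt_continuous).
  assert (Hpc : forall y, continuous (RInt f a) y) by (intros; eapply is_derive_continuous, Hp).
  assert (HN : filterlim N (locally' x) (locally 0)) by now apply (log_primitive_lim c phi phi1 phi2 phi3).
  assert (HR : forall u v, u <= v -> (forall y, u <= y <= v -> y <> x) ->
    RInt (fun y => f y * phi (x - y)) u v = N v - N u).
  { intros u v Huv Hne. apply (is_RInt_unique (V := R_CompleteNormedModule)).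
    apply is_RInt_primitive; [exact Huv| |].
    - intros y Hy. apply (is_derive_log_primitive c phi phi1 phi2 phi3); auto.
    - intros y Hy. apply (continuous_mult f (fun y => phi (x - y))); [apply Hf|].
      apply continuous_reflect. specialize (Hne y Hy).
      eapply is_derive_continuous, (lk_derive0 _ _ _ _ _ HK). lra. }
  assert (Hl : filterlim (fun e => x - e) (at_right 0) (locally' x)).
  { intros P [d Hd]. exists d. intros e He He0. apply Hd; [|lra].
    change (Rabs (x - e - x) < d). replace (x - e - x) with (- (e - 0)) by ring. now rewrite Rabs_Ropp. }
  assert (Hr : filterlim (fun e => x + e) (at_right 0) (locally' x)).
  { intros P [d Hd]. exists d. intros e He He0. apply Hd; [|lra].
    change (Rabs (x + e - x) < d). now replace (x + e - x) with (e - 0) by ring. }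
  assert (H : filterlim (fun e => (N (x - e) + - N a) + (-1 * N (x + e) + N b)) (at_right 0) (locally (- N a + N b))).
  { apply (filterlim_Rplus (at_right 0) _ _ (- N a) (N b)); [| |ring].
    - apply (filterlim_Rplus (at_right 0) _ _ 0 (- N a)); [|apply filterlim_const|ring].
      exact (filterlim_comp _ _ _ _ N _ _ _ Hl HN).
    - apply (filterlim_Rplus (at_right 0) _ _ 0 (N b)); [|apply filterlim_const|ring].
      apply (filterlim_Rmult (at_right 0) _ _ (-1) 0); [apply filterlim_const| |ring].
      exact (filterlim_comp _ _ _ _ N _ _ _ Hr HN). }
  refine (filterlim_ext_loc _ _ _ H).
  assert (Hm : 0 < Rmin (x - a) (b - x)) by (apply Rmin_case; lra).
  assert (H1 := Rmin_l (x - a) (b - x)). assert (H2 := Rmin_r (x - a) (b - x)).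
  generalize (at_right_0_lt _ Hm). apply filter_imp. intros e He. unfold truncated_RInt.
  rewrite !HR by (try lra; intros; lra). ring.
Qed.

Lemma truncated_RInt_ext (f g : R -> R) (a x b e : R) : a <= x - e -> x + e <= b ->
  (forall y, y < x - e \/ x + e < y -> f y = g y) ->
  truncated_RInt f a x b e = truncated_RInt g a x b e.
Proof.
  intros Ha Hb H. unfold truncated_RInt.
  f_equal; apply (RInt_ext (V := R_CompleteNormedModule)); intros y Hy;
    rewrite Rmin_left, Rmax_right in Hy by lra; apply H; lra.
Qed.

Lemma truncated_RInt_linear (f g : R -> R) (a x b e k : R) :
  ex_RInt f a (x - e) -> ex_RInt f (x + e) b -> ex_RInt g a (x - e) -> ex_RInt g (x + e) b ->
  truncated_RInt (fun y => f y + k * g y) a x b e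
  = truncated_RInt f a x b e + k * truncated_RInt g a x b e.
Proof.
  intros F1 F2 G1 G2. unfold truncated_RInt.
  assert (H : forall u v, ex_RInt f u v -> ex_RInt g u v ->
    RInt (fun y => f y + k * g y) u v = RInt f u v + k * RInt g u v).
  { intros u v Hf Hg. apply (is_RInt_unique (V := R_CompleteNormedModule)).
    apply (is_RInt_plus (V := R_NormedModule) f (fun y => k * g y)).
    - apply (RInt_correct (V := R_CompleteNormedModule)), Hf.
    - apply (is_RInt_scal (V := R_NormedModule)), (RInt_correct (V := R_CompleteNormedModule)), Hg. }
  rewrite !H by auto. ring.
Qed.

Lemma radial_layer (c k a x b : R) (K0 K1 f g : R -> R) :
  0 < k -> radial_kernel c K0 K1 -> a < x < b -> (forall y, continuous f y) ->
  (forall y, a < y < b -> is_derive f y (g y)) -> (forall y, a < y < b -> continuous g y) ->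
  f a = 0 -> f b = 0 ->
  exists V1 V2 G1 G2 A,
    layer k a x b (fun s y => g y * K0 (k * Rabs (s - y))) (fun y => f y * K0 (k * Rabs (x - y)))
      (fun y => f y * (/ Rabs (x - y) * K1 (k * Rabs (x - y)))) V1 V2 G1 G2 A.
Proof.
  intros Hk HK0 Hx Hf Hg Hgc Ha Hb.
  assert (HK := line_log_kernel c k K0 K1 Hk HK0).
  set (phi := line_kernel0 k K0) in *. set (phi1 := line_kernel1 k K1) in *.
  set (phi2 := line_kernel2 k K0 K1) in *. set (phi3 := line_kernel3 k K0 K1) in *.
  set (P := fun s => log_primitive c phi phi1 f (g s) s).
  set (N := log_primitive c phi phi1 (RInt f a) (f x) x).
  set (h1 := fun y => f y * (/ Rabs (x - y) * K1 (k * Rabs (x - y)))).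
  set (F2 := fun y => f y * phi2 (x - y)). set (F0 := fun y => f y * phi (x - y)).
  assert (Hp : forall y, is_derive (RInt f a) y (f y)) by (intros; now apply is_derive_RInt_continuous).
  assert (Hpc : forall y, continuous (RInt f a) y) by (intros; eapply is_derive_continuous, Hp).
  destruct (log_integral c phi phi1 phi2 phi3 (RInt f a) f a x b HK Hpc Hx (fun y _ => Hp y) (fun y _ => Hf y)) as [HG1 HG2].
  fold N in HG1, HG2.
  assert (Hm : 0 < Rmin (x - a) (b - x)) by (apply Rmin_case; lra).
  assert (H1 := Rmin_l (x - a) (b - x)). assert (H2 := Rmin_r (x - a) (b - x)).
  assert (E2 : forall u v, u <= v -> (forall y, u <= y <= v -> y <> x) -> ex_RInt F2 u v).
  { intros u v Huv Hne. apply ex_RInt_continuous_le; [exact Huv|]. intros y Hy.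
    apply (continuous_mult f); [apply Hf|]. apply (continuous_kernel2 c phi phi1 phi2 phi3); auto. }
  assert (E0 : forall u v, u <= v -> (forall y, u <= y <= v -> y <> x) -> ex_RInt F0 u v).
  { intros u v Huv Hne. apply ex_RInt_continuous_le; [exact Huv|]. intros y Hy. specialize (Hne y Hy).
    apply (continuous_mult f); [apply Hf|]. apply continuous_reflect.
    eapply is_derive_continuous, (lk_derive0 _ _ _ _ _ HK). lra. }
  (* Bessel's equation [phi'' + k^2 phi = k H1(k |t|) / |t|] *)
  assert (Hbessel : forall y, y <> x -> h1 y = / k * (F2 y + k ^ 2 * F0 y)).
  { intros y Hy. unfold h1, F2, F0, phi2, phi, line_kernel2, line_kernel0.
    field. split; [|lra]. apply Rabs_no_R0. lra. }
  assert (Eh : forall u v, u <= v -> (forall y, u <= y <= v -> y <> x) -> ex_RInt h1 u v).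
  { intros u v Huv Hne. apply (ex_RInt_ext (V := R_NormedModule)) with (fun y => / k * (F2 y + k ^ 2 * F0 y)).
    - rewrite Rmin_left, Rmax_right by lra. intros y Hy. symmetry. apply Hbessel, Hne. lra.
    - apply (ex_RInt_scal (V := R_NormedModule) (fun y => F2 y + k ^ 2 * F0 y)).
      apply (ex_RInt_plus (V := R_NormedModule) F2 (fun y => k ^ 2 * F0 y)); [now apply E2|].
      apply (ex_RInt_scal (V := R_NormedModule)). now apply E0. }
  assert (Htr : forall e, 0 < e < Rmin (x - a) (b - x) ->
    k * truncated_RInt h1 a x b e = truncated_RInt F2 a x b e + k ^ 2 * truncated_RInt F0 a x b e).
  { intros e He.
    rewrite <- truncated_RInt_linear by (try apply E2; try apply E0; try lra; intros; lra).
    rewrite (truncated_RInt_ext (fun y => F2 y + k ^ 2 * F0 y) (fun y => 0 + k * h1 y)); [|lra|lra|].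
    2: { intros y Hy. rewrite Hbessel by lra. field. lra. }
    rewrite (truncated_RInt_linear (fun _ => 0)) by (try apply (ex_RInt_const (V := R_NormedModule)); apply Eh; try lra; intros; lra).
    unfold truncated_RInt at 2. rewrite !(RInt_const (V := R_CompleteNormedModule)).
    unfold scal; simpl; unfold mult; simpl. ring. }
  assert (HG : filterlim (truncated_RInt F0 a x b) (at_right 0) (locally (- N a + N b))).
  { now apply (truncated_RInt_single_layer c phi phi1 phi2 phi3). }
  (* The primitives vanish at their singularities, so each side of the singularity keeps one end
     point. The sign of the last witness turns [- A / |h|] into the compensating term
     [2 c f (x) / |h|]. *)
  exists (fun s => - P s a), (fun s => P s b), (- N a), (N b), (- (2 * c * f x)).
  split; auto.
  - intros s Hs. now apply (log_integral c phi phi1 phi2 phi3 f g a s b).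
  - intros e He. split; apply Eh; try lra; intros; lra.
  - assert (HS := finite_part_single_layer c a x b phi phi1 phi2 phi3 f g HK Hx Hf Hg (Hgc x Hx) Ha Hb).
    fold F2 in HS.
    assert (H : filterlim (fun h => truncated_RInt F2 a x b (Rabs h) + 2 * c * f x / Rabs h
        - (single_layer c phi phi1 f g a b (x + h) - single_layer c phi phi1 f g a b x) / h
        + k ^ 2 * (truncated_RInt F0 a x b (Rabs h) + - (- N a + N b))) (locally' 0) (locally 0)).
    { apply (filterlim_Rplus (locally' 0) _ _ 0 0); [exact HS| |ring].
      apply (filterlim_Rmult (locally' 0) _ _ (k ^ 2) 0); [apply filterlim_const| |ring].
      apply (filterlim_Rplus (locally' 0) _ _ (- N a + N b) (- (- N a + N b))); [|apply filterlim_const|ring].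
      now apply filterlim_locally'_0. }
    refine (filterlim_ext_loc _ _ _ H).
    generalize (locally'_0_lt _ Hm). apply filter_imp. intros h [Hh0 Hh].
    assert (Hh' := Rabs_pos_lt h Hh0). rewrite Htr by lra.
    unfold single_layer, P. field. lra.
  - assert (HD := finite_part_dyadic c a x b phi phi1 phi2 phi3 f g HK Hx Hf Hg (Hgc x Hx)).
    cbv zeta in HD. fold F2 in HD.
    assert (HG' : filterlim (fun e => truncated_RInt F0 a x b (e / 2)) (at_right 0) (locally (- N a + N b))).
    { apply (filterlim_comp _ _ _ (fun e => e / 2) (truncated_RInt F0 a x b) _ (at_right 0)); [|exact HG].
      apply (filterlim_ext (fun e => / 2 * e)); [intros; field|]. apply at_right_scale. lra. }
    assert (H : filterlim (fun e => (truncated_RInt F2 a x b e + 2 * c * f x / e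
        - (truncated_RInt F2 a x b (e / 2) + 2 * c * f x / (e / 2)))
        + (k ^ 2 * truncated_RInt F0 a x b e + - k ^ 2 * truncated_RInt F0 a x b (e / 2))) (at_right 0) (locally 0)).
    { apply (filterlim_Rplus (at_right 0) _ _ 0 0); [exact HD| |ring].
      apply (filterlim_Rplus (at_right 0) _ _ (k ^ 2 * (- N a + N b)) (- k ^ 2 * (- N a + N b))); [| |ring].
      - eapply (filterlim_Rmult (at_right 0)); [apply filterlim_const|exact HG|reflexivity].
      - eapply (filterlim_Rmult (at_right 0)); [apply filterlim_const|exact HG'|reflexivity]. }
    refine (filterlim_ext_loc _ _ _ H).
    generalize (at_right_0_lt _ Hm). apply filter_imp. intros e He.
    rewrite !Htr by lra. field. lra.
Qed.

(** Serves to assemble the real and imaginary parts of a complex product from real layers. *)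
Lemma layer_linear (k a x b sigma : R) (h0 h0' : R -> R -> R) (hG hG' h1 h1' : R -> R)
    (V1 V2 V1' V2' : R -> R) (G1 G2 A G1' G2' A' : R) : a < x < b ->
  layer k a x b h0 hG h1 V1 V2 G1 G2 A -> layer k a x b h0' hG' h1' V1' V2' G1' G2' A' ->
  layer k a x b (fun s y => h0 s y + sigma * h0' s y) (fun y => hG y + sigma * hG' y)
    (fun y => h1 y + sigma * h1' y) (fun s => V1 s + sigma * V1' s) (fun s => V2 s + sigma * V2' s)
    (G1 + sigma * G1') (G2 + sigma * G2') (A + sigma * A').
Proof.
  intros Hx [L1 L2 L3 L4 L5 L6] [L1' L2' L3' L4' L5' L6'].
  assert (Hlin : forall (Fa Fb : (R -> Prop) -> Prop) (FFa : Filter Fa) (FFb : Filter Fb) (f g : R -> R) (l m : R),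
    is_RInt_gen f Fa Fb l -> is_RInt_gen g Fa Fb m ->
    is_RInt_gen (fun y => f y + sigma * g y) Fa Fb (l + sigma * m)).
  { intros Fa Fb FFa FFb f g l m Hf Hg.
    apply (is_RInt_gen_plus (V := R_NormedModule) f (fun y => sigma * g y)); [exact Hf|].
    apply (is_RInt_gen_scal (V := R_NormedModule)). exact Hg. }
  assert (Hm : 0 < Rmin (x - a) (b - x)) by (apply Rmin_case; lra).
  assert (Htr : forall e, 0 < e < Rmin (x - a) (b - x) ->
    truncated_RInt (fun y => h1 y + sigma * h1' y) a x b e
    = truncated_RInt h1 a x b e + sigma * truncated_RInt h1' a x b e).
  { intros e He. destruct (L4 e He), (L4' e He). now apply truncated_RInt_linear. }
  split.
  - intros s Hs. destruct (L1 s Hs), (L1' s Hs). split; apply Hlin; auto; typeclasses eauto.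
  - apply Hlin; auto; typeclasses eauto.
  - apply Hlin; auto; typeclasses eauto.
  - intros e He. destruct (L4 e He), (L4' e He).
    split; apply (ex_RInt_plus (V := R_NormedModule) h1 (fun y => sigma * h1' y)); auto;
      now apply (ex_RInt_scal (V := R_NormedModule)).
  - assert (H := filterlim_Rmult (locally' 0) (fun _ => sigma) _ sigma 0 0 (filterlim_const _) L5' (Rmult_0_r _)).
    assert (H' := filterlim_Rplus (locally' 0) _ _ 0 0 0 L5 H (Rplus_0_r _)).
    refine (filterlim_ext_loc _ _ _ H').
    generalize (locally'_0_lt _ Hm). apply filter_imp. intros h [Hh0 Hh].
    assert (Hh' := Rabs_pos_lt h Hh0). rewrite Htr by lra. field. lra.
  - assert (H := filterlim_Rmult (at_right 0) (fun _ => sigma) _ sigma 0 0 (filterlim_const _) L6' (Rmult_0_r _)).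
    assert (H' := filterlim_Rplus (at_right 0) _ _ 0 0 0 L6 H (Rplus_0_r _)).
    refine (filterlim_ext_loc _ _ _ H').
    generalize (at_right_0_lt _ Hm). apply filter_imp. intros e He. rewrite !Htr by lra. field. lra.
Qed.

Lemma layer_ext (k a x b : R) (h0 h0' : R -> R -> R) (hG hG' h1 h1' V1 V2 : R -> R) (G1 G2 A : R) :
  (forall s y, h0 s y = h0' s y) -> (forall y, hG y = hG' y) -> (forall y, h1 y = h1' y) ->
  layer k a x b h0 hG h1 V1 V2 G1 G2 A -> layer k a x b h0' hG' h1' V1 V2 G1 G2 A.
Proof.
  intros E0 EG E1.
  replace h0' with h0 by (do 2 (apply functional_extensionality; intros); apply E0).
  replace hG' with hG by (apply functional_extensionality, EG).
  replace h1' with h1 by (apply functional_extensionality, E1). auto.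
Qed.

(* Halving [eps] doubles [1 / eps] and shifts [ln eps] by a constant, which
   identifies the two divergent coefficients. *)
Lemma divergent_coefficients (T : R -> R) (A B F : R) :
  filterlim (fun e => T e - T (e / 2)) (at_right 0) (locally 0) ->
  filterlim (fun e => T e - A * / e - B * ln e) (at_right 0) (locally F) ->
  A = 0 /\ B = 0.
Proof.
  intros HT HF.
  assert (Hhalf : filterlim (fun e => e / 2) (at_right 0) (at_right 0)).
  { apply (filterlim_ext (fun e => / 2 * e)); [intros; field|]. apply at_right_scale. lra. }
  assert (HF2 := filterlim_comp _ _ _ _ _ _ _ _ Hhalf HF).
  assert (Hid : filterlim (fun e : R => e) (at_right 0) (locally 0)).
  { apply filterlim_at_right_0; [apply continuous_id|reflexivity]. }
  (* This is what is left of the difference of the expansions at [e] and [e / 2]. Multiplying it by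
     [e] forces [A = 0], after which [B ln 2] must vanish. *)
  assert (H : filterlim (fun e => A * / e + - B * ln 2) (at_right 0) (locally 0)).
  { assert (H0 : filterlim (fun e => (T e - A * / e - B * ln e)
        + (-1 * (T (e / 2) - A * / (e / 2) - B * ln (e / 2)) + -1 * (T e - T (e / 2)))) (at_right 0) (locally 0)).
    { apply (filterlim_Rplus (at_right 0) _ _ F (- F)); [exact HF| |ring].
      apply (filterlim_Rplus (at_right 0) _ _ (- F) 0); [| |ring].
      - apply (filterlim_Rmult (at_right 0) _ _ (-1) F); [apply filterlim_const|exact HF2|ring].
      - apply (filterlim_Rmult (at_right 0) _ _ (-1) 0); [apply filterlim_const|exact HT|ring]. }
    refine (filterlim_ext_loc _ _ _ H0).
    generalize (at_right_0_lt 1 Rlt_0_1). apply filter_imp. intros e He.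
    rewrite ln_div by lra. field. lra. }
  assert (HA : A = 0).
  { assert (H1 : filterlim (fun e => e * (A * / e + - B * ln 2) + e * (B * ln 2)) (at_right 0) (locally 0)).
    { apply (filterlim_Rplus (at_right 0) _ _ 0 0); [| |ring].
      - apply (filterlim_Rmult (at_right 0) _ _ 0 0); [exact Hid|exact H|ring].
      - apply (filterlim_Rmult (at_right 0) _ _ 0 (B * ln 2)); [exact Hid|apply filterlim_const|ring]. }
    apply (filterlim_locally_unique (K := R_AbsRing) (V := R_NormedModule) (F := at_right 0) (fun _ => A)).
    - apply filterlim_const.
    - refine (filterlim_ext_loc _ _ _ H1).
      generalize (at_right_0_lt 1 Rlt_0_1). apply filter_imp. intros e He. simpl. field. lra. }
  split; [exact HA|]. subst A.
  assert (HB : - B * ln 2 = 0).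
  { apply (filterlim_locally_unique (K := R_AbsRing) (V := R_NormedModule) (F := at_right 0) (fun _ => - B * ln 2)).
    - apply filterlim_const.
    - refine (filterlim_ext _ _ _ H). intros e. simpl. ring. }
  pose proof ln_lt_2. apply Rmult_integral in HB. lra.
Qed.

(** The given coefficients satisfy [k alpha = A] and [beta = 0] by [divergent_coefficients]. Hence
    [k] times the truncated integral minus [A / e] itself converges, and [layer_limit] passes
    convergence on to the difference quotient. *)
Lemma layer_derive (k a x b : R) (h0 : R -> R -> R) (hG h1 V1 V2 : R -> R) (G1 G2 A alpha beta F : R) :
  0 < k -> layer k a x b h0 hG h1 V1 V2 G1 G2 A ->
  filterlim (fun e => truncated_RInt h1 a x b e - alpha * / e - beta * ln e) (at_right 0) (locally F) ->
  is_derive (fun s => V1 s + V2 s) x (k * F - k ^ 2 * (G1 + G2)).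
Proof.
  intros Hk HL HF.
  set (T := fun e => k * truncated_RInt h1 a x b e - A / e).
  assert (HkF : filterlim (fun e => T e - (k * alpha - A) * / e - (k * beta) * ln e) (at_right 0) (locally (k * F))).
  { apply (filterlim_ext (fun e => k * (truncated_RInt h1 a x b e - alpha * / e - beta * ln e))).
    - intros e. unfold T, Rdiv. ring.
    - eapply (filterlim_Rmult (at_right 0)); [apply filterlim_const|exact HF|reflexivity]. }
  destruct (divergent_coefficients T _ _ _ (layer_dyadic _ _ _ _ _ _ _ _ _ _ _ _ HL) HkF) as [H1 H2].
  rewrite H1, H2 in HkF.
  assert (HT : filterlim T (at_right 0) (locally (k * F))).
  { refine (filterlim_ext _ _ _ HkF). intros e. ring. }
  (* Setting [eps = |h|] turns the one-sided limit into the two-sided one required for a derivative;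
     this is why [layer_limit] truncates at [|h|]. *)
  apply filterlim_locally'_0 in HT.
  apply is_derive_difference_quotient.
  assert (H : filterlim (fun h => (T (Rabs h) + - (k ^ 2 * (G1 + G2))) + -1 * (k * truncated_RInt h1 a x b (Rabs h)
     - A / Rabs h - k ^ 2 * (G1 + G2) - ((V1 (x + h) + V2 (x + h)) - (V1 x + V2 x)) / h))
     (locally' 0) (locally (k * F - k ^ 2 * (G1 + G2)))).
  { apply (filterlim_Rplus (locally' 0) _ _ (k * F - k ^ 2 * (G1 + G2)) 0); [| |ring].
    - apply (filterlim_Rplus (locally' 0) _ _ (k * F) (- (k ^ 2 * (G1 + G2)))); [exact HT|apply filterlim_const|ring].
    - apply (filterlim_Rmult (locally' 0) _ _ (-1) 0); [apply filterlim_const| |ring].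
      apply (layer_limit _ _ _ _ _ _ _ _ _ _ _ _ HL). }
  refine (filterlim_ext _ _ _ H). intros h. unfold T. ring.
Qed.

(** Converse of [layer_derive]: [layer_limit] is restricted to [h > 0] and solved for the truncated
    integral, which shows the coefficient of [1 / eps] explicitly and no logarithm. *)
Lemma layer_finite_part (k a x b : R) (h0 : R -> R -> R) (hG h1 V1 V2 : R -> R) (G1 G2 A D : R) :
  0 < k -> layer k a x b h0 hG h1 V1 V2 G1 G2 A -> is_derive (fun s => V1 s + V2 s) x D ->
  filterlim (fun e => truncated_RInt h1 a x b e - A / k * / e) (at_right 0) (locally (k * (G1 + G2) + D / k)).
Proof.
  intros Hk HL HD. apply is_derive_difference_quotient in HD.
  assert (H : filterlim (fun h => / k * ((k * truncated_RInt h1 a x b (Rabs h)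
     - A / Rabs h - k ^ 2 * (G1 + G2) - ((V1 (x + h) + V2 (x + h)) - (V1 x + V2 x)) / h)
     + (k ^ 2 * (G1 + G2) + ((V1 (x + h) + V2 (x + h)) - (V1 x + V2 x)) / h)))
     (locally' 0) (locally (k * (G1 + G2) + D / k))).
  { apply (filterlim_Rmult (locally' 0) _ _ (/ k) (k ^ 2 * (G1 + G2) + D)); [apply filterlim_const| |field; lra].
    apply (filterlim_Rplus (locally' 0) _ _ 0 (k ^ 2 * (G1 + G2) + D)); [apply (layer_limit _ _ _ _ _ _ _ _ _ _ _ _ HL)| |ring].
    eapply (filterlim_Rplus (locally' 0)); [apply filterlim_const|exact HD|reflexivity]. }
  apply filterlim_at_right_locally' in H.
  refine (filterlim_ext_loc _ _ _ H).
  generalize (at_right_0_lt 1 Rlt_0_1). apply filter_imp. intros e He.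
  rewrite Rabs_pos_eq by lra. field. lra.
Qed.

(** * Complex-valued limits, integrals and derivatives by components *)

Lemma filterlim_C {T} (F : (T -> Prop) -> Prop) {FF : Filter F} (f : T -> C) (l : C) :
  filterlim (fun t => fst (f t)) F (locally (fst l)) ->
  filterlim (fun t => snd (f t)) F (locally (snd l)) ->
  filterlim f F (locally l).
Proof.
  intros H1 H2. apply filterlim_locally. intros eps.
  apply (filter_imp (fun t => ball (fst l) eps (fst (f t)) /\ ball (snd l) eps (snd (f t)))); [easy|].
  apply filter_and; [now apply filterlim_locally with (eps := eps) in H1|now apply filterlim_locally with (eps := eps) in H2].
Qed.

Lemma filterlim_C_fst {T} (F : (T -> Prop) -> Prop) {FF : Filter F} (f : T -> C) (l : C) :
  filterlim f F (locally l) -> filterlim (fun t => fst (f t)) F (locally (fst l)).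
Proof.
  intros H. apply filterlim_locally. intros eps.
  apply filterlim_locally with (eps := eps) in H. revert H. apply filter_imp. intros t [H _]. exact H.
Qed.

Lemma filterlim_C_snd {T} (F : (T -> Prop) -> Prop) {FF : Filter F} (f : T -> C) (l : C) :
  filterlim f F (locally l) -> filterlim (fun t => snd (f t)) F (locally (snd l)).
Proof.
  intros H. apply filterlim_locally. intros eps.
  apply filterlim_locally with (eps := eps) in H. revert H. apply filter_imp. intros t [_ H]. exact H.
Qed.

Lemma is_RInt_gen_C (f : R -> C) (Fa Fb : (R -> Prop) -> Prop) {FFa : Filter Fa} {FFb : Filter Fb} (l1 l2 : R) :
  is_RInt_gen (fun t => fst (f t)) Fa Fb l1 -> is_RInt_gen (fun t => snd (f t)) Fa Fb l2 ->
  @is_RInt_gen C_R_NormedModule f Fa Fb (l1, l2).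
Proof.
  intros H1 H2 P [eps HP]. unfold filtermapi.
  specialize (H1 _ (locally_ball l1 eps)). specialize (H2 _ (locally_ball l2 eps)).
  unfold filtermapi in H1, H2.
  generalize (filter_and _ _ H1 H2). apply filter_imp.
  intros uv [[y1 [I1 B1]] [y2 [I2 B2]]]. exists (y1, y2). split.
  - exact (is_RInt_fct_extend_pair (U := R_NormedModule) (V := R_NormedModule) f _ _ y1 y2 I1 I2).
  - apply HP. now split.
Qed.

Lemma is_RInt_gen_C_fst (f : R -> C) (Fa Fb : (R -> Prop) -> Prop) {FFa : Filter Fa} {FFb : Filter Fb} (l : C) :
  @is_RInt_gen C_R_NormedModule f Fa Fb l -> is_RInt_gen (fun t => fst (f t)) Fa Fb (fst l).
Proof.
  intros H P [eps HP]. unfold filtermapi. specialize (H _ (locally_ball (l : C_R_NormedModule) eps)).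
  unfold filtermapi in H. revert H. apply filter_imp. intros uv [y [I B]]. exists (fst y). split.
  - exact (is_RInt_fct_extend_fst (U := R_NormedModule) (V := R_NormedModule) f _ _ y I).
  - apply HP, B.
Qed.

Lemma is_RInt_gen_C_snd (f : R -> C) (Fa Fb : (R -> Prop) -> Prop) {FFa : Filter Fa} {FFb : Filter Fb} (l : C) :
  @is_RInt_gen C_R_NormedModule f Fa Fb l -> is_RInt_gen (fun t => snd (f t)) Fa Fb (snd l).
Proof.
  intros H P [eps HP]. unfold filtermapi. specialize (H _ (locally_ball (l : C_R_NormedModule) eps)).
  unfold filtermapi in H. revert H. apply filter_imp. intros uv [y [I B]]. exists (snd y). split.
  - exact (is_RInt_fct_extend_snd (U := R_NormedModule) (V := R_NormedModule) f _ _ y I).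
  - apply HP, B.
Qed.

Lemma is_derive_C (f : R -> C) (x d1 d2 : R) :
  is_derive (fun t => fst (f t)) x d1 -> is_derive (fun t => snd (f t)) x d2 ->
  @is_derive R_AbsRing C_R_NormedModule f x (d1, d2).
Proof.
  intros H1 H2.
  assert (H := is_derive_plus (V := C_R_NormedModule) _ _ x _ _
    (is_derive_scal_l (V := C_R_NormedModule) _ x d1 ((1, 0) : C) H1)
    (is_derive_scal_l (V := C_R_NormedModule) _ x d2 ((0, 1) : C) H2)).
  evar_last; [refine (is_derive_ext _ _ _ _ _ H)|].
  - intros t. apply injective_projections.
    + change (fst (f t) * 1 + snd (f t) * 0 = fst (f t)). ring.
    + change (fst (f t) * 0 + snd (f t) * 1 = snd (f t)). ring.
  - apply injective_projections.
    + change (d1 * 1 + d2 * 0 = d1). ring.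
    + change (d1 * 0 + d2 * 1 = d2). ring.
Qed.

Lemma is_derive_C_fst (f : R -> C) (x : R) (d : C) :
  @is_derive R_AbsRing C_R_NormedModule f x d -> is_derive (fun t => fst (f t)) x (fst d).
Proof.
  intros H.
  exact (filterdiff_comp' f (fst : C_R_NormedModule -> R_NormedModule) x _ fst H (filterdiff_linear _ is_linear_fst)).
Qed.

Lemma is_derive_C_snd (f : R -> C) (x : R) (d : C) :
  @is_derive R_AbsRing C_R_NormedModule f x d -> is_derive (fun t => snd (f t)) x (snd d).
Proof.
  intros H.
  exact (filterdiff_comp' f (snd : C_R_NormedModule -> R_NormedModule) x _ snd H (filterdiff_linear _ is_linear_snd)).
Qed.

(** * The boundary conditions *)

Definition potential_integrand (k : R) (u : R * R -> C) (s y : R) : C :=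
  (Defs.d1 u (y, 0) * hankel1 0 (k * Rabs (s - y)))%C.

Definition weak_integrand (k : R) (u : R * R -> C) (x y : R) : C :=
  (u (y, 0) * hankel1 0 (k * Rabs (x - y)))%C.

Definition hypersingular_integrand (k : R) (u : R * R -> C) (x y : R) : C :=
  (RtoC (/ Rabs (x - y)) * hankel1 1 (k * Rabs (x - y)) * u (y, 0))%C.

Lemma filterlim_axis (y : R) : filterlim (fun s : R => (s, 0)) (locally y) (locally (y, 0)).
Proof.
  intros P [eps HP]. exists eps. intros s Hs. apply HP. split; [exact Hs|apply ball_center].
Qed.

(** The whole axis lies in [closed_domain], so the trace is continuous on all of the line, edges
    included, as the lemmas on [f] assume. *)
Lemma trace_continuous (kappa0 theta a b h : R) (kappa u : R * R -> C) (y : R) :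
  total_field kappa0 theta a b h kappa u ->
  filterlim (fun s => u (s, 0)) (locally y) (locally (u (y, 0))).
Proof.
  intros Hu. assert (Hc := tf_continuous _ _ _ _ _ _ _ Hu (y, 0) (or_introl (Rle_refl 0))).
  refine (filterlim_comp _ _ _ (fun s : R => (s, 0)) u _ _ _ _ Hc).
  intros P HP. generalize (filterlim_axis y _ HP). unfold filtermap. apply filter_imp.
  intros s Hs. apply Hs. left. simpl. lra.
Qed.

Lemma trace_derive (u : R * R -> C) (y : R) : C1_at u (y, 0) ->
  is_derive (fun s => fst (u (s, 0))) y (fst (Defs.d1 u (y, 0))) /\
  is_derive (fun s => snd (u (s, 0))) y (snd (Defs.d1 u (y, 0))).
Proof.
  intros [Hl _]. apply locally_singleton in Hl. destruct Hl as [[d Hd] _]. simpl in Hd.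
  split; apply Derive_correct.
  - exists (fst d). exact (is_derive_C_fst _ _ _ Hd).
  - exists (snd d). exact (is_derive_C_snd _ _ _ Hd).
Qed.

Lemma trace_derive_continuous (u : R * R -> C) (y : R) : C1_at u (y, 0) ->
  continuous (fun s => fst (Defs.d1 u (s, 0))) y /\ continuous (fun s => snd (Defs.d1 u (s, 0))) y.
Proof.
  intros [_ [Hc _]].
  assert (H := filterlim_comp _ _ _ (fun s : R => (s, 0)) (Defs.d1 u) _ _ _ (filterlim_axis y) Hc).
  split; [exact (filterlim_C_fst _ _ _ H)|exact (filterlim_C_snd _ _ _ H)].
Qed.

Lemma total_field_layers (kappa0 theta a b h : R) (kappa u : R * R -> C) (x : R) :
  0 < kappa0 -> 0 < h -> total_field kappa0 theta a b h kappa u -> a < x < b ->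
  (exists V1 V2 G1 G2 A, layer kappa0 a x b
    (fun s y => fst (potential_integrand kappa0 u s y)) (fun y => fst (weak_integrand kappa0 u x y))
    (fun y => fst (hypersingular_integrand kappa0 u x y)) V1 V2 G1 G2 A) /\
  (exists V1 V2 G1 G2 A, layer kappa0 a x b
    (fun s y => snd (potential_integrand kappa0 u s y)) (fun y => snd (weak_integrand kappa0 u x y))
    (fun y => snd (hypersingular_integrand kappa0 u x y)) V1 V2 G1 G2 A).
Proof.
  intros Hk Hh Hu Hx.
  assert (HC1 : forall y, a < y < b -> C1_at u (y, 0)).
  { intros y Hy. apply (tf_C1 _ _ _ _ _ _ _ Hu). right. left. now split. }
  (* The edge is the upper end of a vertical wall, where the conductor condition applies. *)
  assert (Ha : u (a, 0) = RtoC 0).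
  { apply (tf_conductor _ _ _ _ _ _ _ Hu). right. left. simpl. lra. }
  assert (Hb : u (b, 0) = RtoC 0).
  { apply (tf_conductor _ _ _ _ _ _ _ Hu). right. left. simpl. lra. }
  assert (Hc := fun y => trace_continuous kappa0 theta a b h kappa u y Hu).
  assert (HL1 := fun c K0 K1 HK => radial_layer c kappa0 a x b K0 K1 (fun y => fst (u (y, 0))) (fun y => fst (Defs.d1 u (y, 0)))
    Hk HK Hx (fun y => filterlim_C_fst _ _ _ (Hc y)) (fun y Hy => proj1 (trace_derive u y (HC1 y Hy)))
    (fun y Hy => proj1 (trace_derive_continuous u y (HC1 y Hy))) (f_equal fst Ha) (f_equal fst Hb)).
  assert (HL2 := fun c K0 K1 HK => radial_layer c kappa0 a x b K0 K1 (fun y => snd (u (y, 0))) (fun y => snd (Defs.d1 u (y, 0)))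
    Hk HK Hx (fun y => filterlim_C_snd _ _ _ (Hc y)) (fun y Hy => proj2 (trace_derive u y (HC1 y Hy)))
    (fun y Hy => proj2 (trace_derive_continuous u y (HC1 y Hy))) (f_equal snd Ha) (f_equal snd Hb)).
  destruct (HL1 _ _ _ bessel_J_kernel) as (? & ? & ? & ? & ? & L1J).
  destruct (HL1 _ _ _ bessel_Y_kernel) as (? & ? & ? & ? & ? & L1Y).
  destruct (HL2 _ _ _ bessel_J_kernel) as (? & ? & ? & ? & ? & L2J).
  destruct (HL2 _ _ _ bessel_Y_kernel) as (? & ? & ? & ? & ? & L2Y).
  split; do 5 eexists.
  - refine (layer_ext _ _ _ _ _ _ _ _ _ _ _ _ _ _ _ _ _ _ (layer_linear _ _ _ _ (-1) _ _ _ _ _ _ _ _ _ _ _ _ _ _ _ _ Hx L1J L2Y));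
      intros; cbn [fst snd potential_integrand weak_integrand hypersingular_integrand Cmult hankel1 RtoC]; ring.
  - refine (layer_ext _ _ _ _ _ _ _ _ _ _ _ _ _ _ _ _ _ _ (layer_linear _ _ _ _ 1 _ _ _ _ _ _ _ _ _ _ _ _ _ _ _ _ Hx L1Y L2J));
      intros; cbn [fst snd potential_integrand weak_integrand hypersingular_integrand Cmult hankel1 RtoC]; ring.
Qed.

(** [reformulated_tbc] quantifies existentially over its integrals; this identifies them with those
    built from the layers. *)
Lemma is_improper_RInt_unique (f : R -> C) (a x b : R) (l m : C) : a < x < b ->
  is_improper_RInt f a x b l -> is_improper_RInt f a x b m -> l = m.
Proof.
  intros Hx (l1 & l2 & Hl1 & Hl2 & ->) (m1 & m2 & Hm1 & Hm2 & ->).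
  assert (U : forall Fa Fb (FFa : ProperFilter' Fa) (FFb : ProperFilter' Fb) (l m : C),
    @is_RInt_gen C_R_NormedModule f Fa Fb l -> @is_RInt_gen C_R_NormedModule f Fa Fb m -> l = m).
  { intros Fa Fb FFa FFb l m Hl Hm. apply injective_projections.
    - rewrite <- (is_RInt_gen_unique _ _ (is_RInt_gen_C_fst _ _ _ _ Hl)).
      exact (is_RInt_gen_unique _ _ (is_RInt_gen_C_fst _ _ _ _ Hm)).
    - rewrite <- (is_RInt_gen_unique _ _ (is_RInt_gen_C_snd _ _ _ _ Hl)).
      exact (is_RInt_gen_unique _ _ (is_RInt_gen_C_snd _ _ _ _ Hm)). }
  f_equal; eapply U; try eassumption; typeclasses eauto.
Qed.

Theorem lemma5p1 (kappa0 theta a b h : R) (kappa u : R * R -> C)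
    (Hkappa0 : 0 < kappa0) (Htheta : - (PI / 2) < theta < PI / 2)
    (Hab : a < b) (Hh : 0 < h)
    (Hkappa : medium kappa0 a b h kappa)
    (Hu : total_field kappa0 theta a b h kappa u)
    (x1 : R) (Hx1 : a < x1 < b) :
  hypersingular_tbc kappa0 theta a b u x1 <->
  reformulated_tbc kappa0 theta a b u x1.
Proof.
  destruct (total_field_layers kappa0 theta a b h kappa u x1 Hkappa0 Hh Hu Hx1)
    as [(V1 & V2 & G1 & G2 & A & L) (W1 & W2 & H1 & H2 & B & M)].
  set (V := fun s => (V1 s + V2 s, W1 s + W2 s) : C).
  set (G := (G1 + G2, H1 + H2) : C).
  assert (HV : forall s, a < s < b -> is_improper_RInt (potential_integrand kappa0 u s) a s b (V s)).
  { intros s Hs. destruct (layer_potential _ _ _ _ _ _ _ _ _ _ _ _ L s Hs).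
    destruct (layer_potential _ _ _ _ _ _ _ _ _ _ _ _ M s Hs).
    exists (V1 s, W1 s), (V2 s, W2 s). repeat split; apply is_RInt_gen_C; auto; typeclasses eauto. }
  assert (HG : is_improper_RInt (weak_integrand kappa0 u x1) a x1 b G).
  { exists (G1, H1), (G2, H2).
    destruct L as [_ ? ? _ _ _], M as [_ ? ? _ _ _].
    repeat split; apply is_RInt_gen_C; auto; typeclasses eauto. }
  assert (Hm : 0 < Rmin (x1 - a) (b - x1)) by (apply Rmin_case; lra).
  set (hr := fun y => fst (hypersingular_integrand kappa0 u x1 y)) in *.
  set (hi := fun y => snd (hypersingular_integrand kappa0 u x1 y)) in *.
  assert (HR : forall p q l, @is_RInt C_R_NormedModule (hypersingular_integrand kappa0 u x1) p q l ->
    RInt hr p q = fst l /\ RInt hi p q = snd l).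
  { intros p q l Hl. split; apply (is_RInt_unique (V := R_CompleteNormedModule)).
    - exact (is_RInt_fct_extend_fst (U := R_NormedModule) (V := R_NormedModule) _ _ _ _ Hl).
    - exact (is_RInt_fct_extend_snd (U := R_NormedModule) (V := R_NormedModule) _ _ _ _ Hl). }
  split.
  - intros (v & F & Hv & (P & Q & I & HI & Hlim) & Ev).
    assert (EI : forall e, 0 < e < Rmin (x1 - a) (b - x1) ->
      I e = (truncated_RInt hr a x1 b e, truncated_RInt hi a x1 b e)).
    { intros e He. destruct (HI e He) as (l1 & l2 & Hl1 & Hl2 & ->).
      destruct (HR _ _ _ Hl1) as [E1 E2], (HR _ _ _ Hl2) as [E3 E4].
      unfold truncated_RInt. rewrite E1, E2, E3, E4.
      reflexivity. }
    assert (Hr : filterlim (fun e => truncated_RInt hr a x1 b e - fst P * / e - fst Q * ln e) (at_right 0) (locally (fst F))).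
    { refine (filterlim_ext_loc _ _ _ (filterlim_C_fst _ _ _ Hlim)).
      generalize (at_right_0_lt _ Hm). apply filter_imp. intros e He. rewrite EI by exact He. simpl. ring. }
    assert (Hi : filterlim (fun e => truncated_RInt hi a x1 b e - snd P * / e - snd Q * ln e) (at_right 0) (locally (snd F))).
    { refine (filterlim_ext_loc _ _ _ (filterlim_C_snd _ _ _ Hlim)).
      generalize (at_right_0_lt _ Hm). apply filter_imp. intros e He. rewrite EI by exact He. simpl. ring. }
    (* Forced by equating the two right-hand sides: [i k F / 2 = i k^2 G / 2 + i D / 2]. *)
    set (D := (RtoC kappa0 * F - RtoC (kappa0 ^ 2) * G)%C).
    exists v, G, D, V. split; [exact Hv|]. split; [exact HG|]. split; [exact HV|]. split.
    + replace D with (kappa0 * fst F - kappa0 ^ 2 * (G1 + G2), kappa0 * snd F - kappa0 ^ 2 * (H1 + H2)).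
      * apply is_derive_C.
        -- exact (layer_derive _ _ _ _ _ _ _ _ _ _ _ _ _ _ _ Hkappa0 L Hr).
        -- exact (layer_derive _ _ _ _ _ _ _ _ _ _ _ _ _ _ _ Hkappa0 M Hi).
      * apply injective_projections; simpl; ring.
    + rewrite Ev. unfold D. field.
  - intros (v & G' & D & V' & Hv & HG' & HV' & HD & Ev).
    rewrite (is_improper_RInt_unique _ _ _ _ _ _ Hx1 HG' HG) in Ev.
    assert (HDV : @is_derive R_AbsRing C_R_NormedModule V x1 D).
    (* [V'] is determined on the open aperture only, which suffices since [x1] is an interior
       point. *)
    { refine (is_derive_ext_loc _ _ _ _ _ HD).
      exists (mkposreal _ Hm). intros s Hs. change (Rabs (s - x1) < Rmin (x1 - a) (b - x1)) in Hs.
      assert (E1 := Rmin_l (x1 - a) (b - x1)). assert (E2 := Rmin_r (x1 - a) (b - x1)).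
      apply Rabs_def2 in Hs. assert (Hs' : a < s < b) by lra.
      exact (is_improper_RInt_unique _ _ _ _ _ _ Hs' (HV' s Hs') (HV s Hs')). }
    assert (Hr := layer_finite_part _ _ _ _ _ _ _ _ _ _ _ _ _ Hkappa0 L (is_derive_C_fst _ _ _ HDV)).
    assert (Hi := layer_finite_part _ _ _ _ _ _ _ _ _ _ _ _ _ Hkappa0 M (is_derive_C_snd _ _ _ HDV)).
    (* The same relation [k F = k^2 G + D], now solved for the finite part. *)
    set (F := (kappa0 * (G1 + G2) + fst D / kappa0, kappa0 * (H1 + H2) + snd D / kappa0) : C).
    assert (EF : (RtoC kappa0 * F)%C = (RtoC (kappa0 ^ 2) * G + D)%C).
    { apply injective_projections; simpl; field; lra. }
    exists v, F. split; [exact Hv|]. split.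
    (* The coefficients of [1 / eps] and [ln eps], as found in [layer_finite_part]. *)
    + exists (A / kappa0, B / kappa0), (RtoC 0), (fun e => (truncated_RInt hr a x1 b e, truncated_RInt hi a x1 b e)).
      split.
      * intros e He. destruct (layer_ex_RInt _ _ _ _ _ _ _ _ _ _ _ _ L e He) as [X1 X2].
        destruct (layer_ex_RInt _ _ _ _ _ _ _ _ _ _ _ _ M e He) as [Y1 Y2].
        exists (RInt hr a (x1 - e), RInt hi a (x1 - e)), (RInt hr (x1 + e) b, RInt hi (x1 + e) b).
        split; [|split; [|reflexivity]];
          apply (is_RInt_fct_extend_pair (U := R_NormedModule) (V := R_NormedModule) (hypersingular_integrand kappa0 u x1));
          now apply (RInt_correct (V := R_CompleteNormedModule)).
      * apply (filterlim_C (at_right 0)).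
        -- refine (filterlim_ext _ _ _ Hr). intros e. simpl. ring.
        -- refine (filterlim_ext _ _ _ Hi). intros e. simpl. ring.
    + rewrite Ev.
      replace (Ci * RtoC kappa0 / RtoC 2 * F)%C with (Ci / RtoC 2 * (RtoC kappa0 * F))%C.
      2: { field. }
      rewrite EF. field.
Qed.
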